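(* Let the data, standing assumptions, mesh family and fully discrete scheme $(U_i^n)$ be as in the context. Assume that the discretization parameters satisfy $$\Delta t\to0,\qquad h\to0,\qquad\frac{h^2}{\Delta t}\to0.$$ Then there is a constant $C$, independent of the discretization parameters, such that $$\max_{0\le n\le N_T}\|U^n\|_\infty\le C$$ for all sufficiently fine grids, where $\|U^n\|_\infty=\max_{i\in\mathcal I_h}|U_i^n|$.
   Context: **Data and standing assumptions.** $T>0$; $\mathcal O\subset\mathbb R^N$ is a nonempty bounded domain with boundary of class $C^3$; $n(x)$ is the unit outward normal at $x\in\partial\mathcal O$; $A\subset\mathbb R^{N_A}$, $B\subset\mathbb R^{N_B}$ are nonempty compact sets; $1\le N_p\le N$. The functions $\sigma:[0,T]\times\overline{\mathcal O}\times A\to\mathbb R^{N\times N_p}$, $\mu:[0,T]\times\overline{\mathcal O}\times A\to\mathbb R^N$, $f,r:[0,T]\times\overline{\mathcal O}\times A\to\mathbb R$, $g,k:[0,T]\times\partial\mathcal O\times B\to\mathbb R$, $\Psi:\overline{\mathcal O}\to\mathbb R$ are continuous; $\sigma(\cdot,\cdot,a)$ and $\mu(\cdot,\cdot,a)$ are Lipschitz with constants independent of $a\in A$; $r\ge0$ and $k\ge0$. The map $\gamma:\partial\mathcal O\times\mathcal V\to\mathbb R^N$, with $\mathcal V\subseteq\mathbb R^{N_B}$ open and $B\subset\mathcal V$, is of class $C^1$, and $|\gamma(x,b)|=1$, $\langle n(x),\gamma(x,b)\rangle>0$ for all $(x,b)\in\partial\mathcal O\times B$. Write $\gamma_b(x)=\gamma(x,b)$.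 **Mesh and interpolation.** For each $h$, $\mathcal O_h$ is a polyhedral approximation of $\mathcal O$ with a shape-regular simplicial triangulation $\mathbb T_h$, $h=\max_{\mathsf T\in\mathbb T_h}\operatorname{diam}\mathsf T$, whose vertices $\mathcal G_h=\{x_i:i\in\mathcal I_h\}$ lie in $\overline{\mathcal O}$; $\mathcal I_h=\mathcal I_h^\circ\,\dot\cup\,\mathcal I_h^\partial$ with $x_i\in\mathcal O$ for $i\in\mathcal I_h^\circ$, $x_i\in\partial\mathcal O$ for $i\in\mathcal I_h^\partial$. $\widehat{\mathbb T}_h$ is the associated exact triangulation of $\overline{\mathcal O}$ with the same vertices and possibly curved boundary elements, and $p_h:\overline{\mathcal O}\to\overline{\mathcal O_h}$ maps each element of $\widehat{\mathbb T}_h$ to the corresponding simplex of $\mathbb T_h$, fixing the vertices. With $\{\psi_j\}$ the continuous piecewise-linear nodal basis on $\mathbb T_h$, $I_h[V](x)=\sum_{j\in\mathcal I_h}\psi_j(p_h(x))V_j$ for $x\in\overline{\mathcal O}$ and a grid vector $V$. The mesh family satisfies $\|I_h[\phi|_{\mathcal G_h}]-\phi\|_{L^\infty(\overline{\mathcal O})}\le C_\phi h^2$ for all $\phi\in C^2(\overline{\mathcal O})$, where $C_\phi$ is independent of $h$ and bounded by a constant times $\|\phi\|_{C^2}$. Time grid: $\Delta t=T/N_T$, $t_n=n\Delta t$. **Oblique projection.** There are $R,\delta>0$ such that for every $x$ with $\operatorname{dist}(x,\partial\mathcal O)<R$ and every $b\in B$ there is a unique pair $(p^{\gamma_b}(x),d^{\gamma_b}(x))\in\partial\mathcal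 O\times(-\delta,\delta)$ with $x=p^{\gamma_b}(x)+d^{\gamma_b}(x)\gamma_b(p^{\gamma_b}(x))$; both are $C^1$ in $(x,b)$. **Branches.** Let $m=N_p$, $P=2^m$, and let $\xi^1,\dots,\xi^P$ be the elements of $\{-1,1\}^m$. For $i\in\mathcal I_h^\circ$, $a\in A$, $b\in B$ put $X^{*,p}=x_i+\Delta t\,\mu(t_n,x_i,a)+\sqrt{\Delta t}\,\sigma(t_n,x_i,a)\xi^p$. If $X^{*,p}\in\overline{\mathcal O}$, set $\widetilde X_p=X^{*,p}$ and $\widetilde d_p=\widetilde k_p=\widetilde g_p=0$. If $X^{*,p}\notin\overline{\mathcal O}$, set $x_b^p=p^{\gamma_b}(X^{*,p})$, $\widetilde d_p=2d^{\gamma_b}(X^{*,p})$, $\widetilde X_p=X^{*,p}-\widetilde d_p\gamma_b(x_b^p)$, $\widetilde k_p=k(t_n,x_b^p,b)$, $\widetilde g_p=g(t_n,x_b^p,b)$. For $\Delta t$ small enough (only such $\Delta t$ are considered) these are well defined with $\widetilde X_p\in\overline{\mathcal O}$. **Scheme.** For a grid vector $V$ and $i\in\mathcal I_h^\circ$, $$\mathcal S_{n,i}^{a,b}[V]=\frac{1}{1+r(t_n,x_i,a)\Delta t}\frac1P\sum_{p=1}^P\big[e^{-\widetilde k_p\widetilde d_p}I_h[V](\widetilde X_p)+\widetilde d_pe^{-\widetilde k_p\widetilde d_p/2}\widetilde g_p\big]+\Delta t\,f(t_n,x_i,a),\qquad S_{n,i}[V]=\inf_{(a,b)\in A\times B}\mathcal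 S_{n,i}^{a,b}[V].$$ Fix constants $0<c_0\le c_1$ and an offset $\ell_h$, independent of $\Delta t$, with $c_0h\le\ell_h\le c_1h$. For $i\in\mathcal I_h^\partial$ (and $h$ small, so that $x_i-\ell_h\gamma(x_i,b)\in\mathcal O$), $$S_{n,i}^{\partial}[V]=\inf_{b\in B}\frac{I_h[V](x_i-\ell_h\gamma(x_i,b))+\ell_hg(t_n,x_i,b)}{1+\ell_hk(t_n,x_i,b)}.$$ The discrete solution is defined by $U_i^{N_T}=\Psi(x_i)$ for $i\in\mathcal I_h$ and, for $n=N_T-1,\dots,0$, $U_i^n=S_{n,i}[U^{n+1}]$ for $i\in\mathcal I_h^\circ$, and then $U_i^n=S_{n,i}^\partial[U^n]$ for $i\in\mathcal I_h^\partial$ (a same-level system for the boundary values, uniquely solvable for small $h$). *)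

(* Defs.v *)
From HB Require Import structures.
From mathcomp Require Import all_boot all_order all_algebra.
From mathcomp Require Import all_classical all_reals all_analysis.
Import Order.TTheory GRing.Theory Num.Theory.
Import numFieldNormedType.Exports.
Set Implicit Arguments.
Unset Strict Implicit.
Unset Printing Implicit Defensive.
Local Open Scope classical_set_scope.
Local Open Scope ring_scope.

(* The norm `|_| of 'rV[R]_N is the sup norm. It gives the right topology, but
   lengths, distances and diameters below are Euclidean. *)
Definition dotp {R : realType} {N : nat} (u v : 'rV[R]_N) : R :=
  \sum_i u 0 i * v 0 i.

Definition enorm {R : realType} {N : nat} (u : 'rV[R]_N) : R :=
  Num.sqrt (dotp u u).

Definition edist {R : realType} {N : nat} (x : 'rV[R]_N) (S : set 'rV[R]_N) : R :=
  inf [set enorm (x - y) | y in S].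

Definition ediam {R : realType} {N : nat} (S : set 'rV[R]_N) : R :=
  sup [set enorm (z.1 - z.2) | z in S `*` S].

Definition inradius {R : realType} {N : nat} (S : set 'rV[R]_N) : R :=
  sup [set r | 0 <= r /\ exists c, [set y | enorm (y - c) <= r] `<=` S].

Definition boundary {T : topologicalType} (S : set T) : set T :=
  closure S `\` interior S.

Definition partial {R : realType} {N : nat} (i : 'I_N) (phi : 'rV[R]_N -> R) :
  'rV[R]_N -> R := 'D_(delta_mx 0 i) phi.

Definition grad {R : realType} {N : nat} (phi : 'rV[R]_N -> R) (x : 'rV[R]_N) :
  'rV[R]_N := \row_i partial i phi x.

(* f is of class C^k on the open set U; in finite dimension, quantifying over all
   directions v amounts to quantifying over the coordinate directions. *)
Fixpoint Ck {R : realType} {V W : normedModType R} (k : nat) (U : set V)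
    (f : V -> W) : Prop :=
  match k with
  | 0 => {within U, continuous f}
  | k'.+1 => (forall x, U x -> differentiable f x) /\
             (forall v, Ck k' U ('D_v f))
  end.

(* C^k on an arbitrary set: locally the restriction of a C^k map defined on an
   open set. *)
Definition Ck_on {R : realType} {V W : normedModType R} (k : nat) (S : set V)
    (f : V -> W) : Prop :=
  forall z, S z -> exists (U : set V) (F : V -> W),
    [/\ open U, U z, Ck k U F & forall y, U y -> S y -> F y = f y].

(* All derivatives of f of order at most k exist on the open set U and extend
   continuously to the closure of U. *)
Fixpoint Ck_ext {R : realType} {V : normedModType R} (k : nat) (U : set V)
    (f : V -> R) : Prop :=
  (exists F : V -> R, {within closure U, continuous F} /\
     forall x, U x -> F x = f x) /\
  match k with
  | 0 => True
  | k'.+1 => (forall x, U x -> differentiable f x) /\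
             (forall v, Ck_ext k' U ('D_v f))
  end.

Definition C2_closure {R : realType} {N : nat} (U : set 'rV[R]_N)
    (phi : 'rV[R]_N -> R) : Prop :=
  {within closure U, continuous phi} /\ Ck_ext 2 U phi.

Definition supnorm {R : realType} {T : Type} (S : set T) (phi : T -> R) : R :=
  sup [set `|phi x| | x in S].

Definition C2norm {R : realType} {N : nat} (U : set 'rV[R]_N)
    (phi : 'rV[R]_N -> R) : R :=
  supnorm U phi + \sum_i supnorm U (partial i phi) +
  \sum_i \sum_j supnorm U (partial i (partial j phi)).

Definition defining_function {R : realType} {N : nat} (k : nat)
    (O : set 'rV[R]_N) (x0 : 'rV[R]_N) (W : set 'rV[R]_N) (phi : 'rV[R]_N -> R)
    : Prop :=
  [/\ open W, W x0, Ck k W phi,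
      forall x, W x -> (O x <-> phi x < 0)
    & forall x, W x -> grad phi x != 0].

Definition Ck_boundary {R : realType} {N : nat} (k : nat) (O : set 'rV[R]_N)
    : Prop :=
  forall x, boundary O x -> exists W phi, defining_function k O x W phi.

Definition is_outward_normal {R : realType} {N : nat} (O : set 'rV[R]_N)
    (x v : 'rV[R]_N) : Prop :=
  exists W phi, defining_function 1 O x W phi /\
    v = (enorm (grad phi x))^-1 *: grad phi x.

Record problem (R : realType) (N Np NA NB : nat) := Problem {
  horizon : R;
  dom : set 'rV[R]_N;
  normal : 'rV[R]_N -> 'rV[R]_N;
  ctrlA : set 'rV[R]_NA;
  ctrlB : set 'rV[R]_NB;
  sigma : R -> 'rV[R]_N -> 'rV[R]_NA -> 'M[R]_(N, Np);
  mu : R -> 'rV[R]_N -> 'rV[R]_NA -> 'rV[R]_N;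
  fcost : R -> 'rV[R]_N -> 'rV[R]_NA -> R;
  rrate : R -> 'rV[R]_N -> 'rV[R]_NA -> R;
  gcost : R -> 'rV[R]_N -> 'rV[R]_NB -> R;
  krate : R -> 'rV[R]_N -> 'rV[R]_NB -> R;
  Psi : 'rV[R]_N -> R;
  domV : set 'rV[R]_NB;
  gamma : 'rV[R]_N -> 'rV[R]_NB -> 'rV[R]_N;
  tubeR : R;
  tubed : R;
  projg : 'rV[R]_N -> 'rV[R]_NB -> 'rV[R]_N;
  distg : 'rV[R]_N -> 'rV[R]_NB -> R
}.

Definition standing_domain {R : realType} {N Np NA NB : nat}
    (D : problem R N Np NA NB) : Prop :=
  [/\ 0 < horizon D,
      [/\ open (dom D), connected (dom D), dom D !=set0 & bounded_set (dom D)],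
      Ck_boundary 3 (dom D)
    & forall x, boundary (dom D) x -> is_outward_normal (dom D) x (normal D x)].

Definition standing_coefficients {R : realType} {N Np NA NB : nat}
    (D : problem R N Np NA NB) : Prop :=
  let I : set R := `[0, horizon D]%classic in
  let cO := closure (dom D) in
  let bO := boundary (dom D) in
  let A := ctrlA D in
  let B := ctrlB D in
  [/\ [/\ A !=set0, compact A, B !=set0 & compact B],
      [/\ {within I `*` cO `*` A, continuous (fun z => sigma D z.1.1 z.1.2 z.2)},
          {within I `*` cO `*` A, continuous (fun z => mu D z.1.1 z.1.2 z.2)},
          {within I `*` cO `*` A, continuous (fun z => fcost D z.1.1 z.1.2 z.2)}
        & {within I `*` cO `*` A, continuous (fun z => rrate D z.1.1 z.1.2 z.2)}],
      [/\ {within I `*` bO `*` B, continuous (fun z => gcost D z.1.1 z.1.2 z.2)},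
          {within I `*` bO `*` B, continuous (fun z => krate D z.1.1 z.1.2 z.2)}
        & {within cO, continuous (Psi D)}],
      exists Lip : R, forall a, A a ->
        Lip.-lipschitz_(I `*` cO) (fun z => sigma D z.1 z.2 a) /\
        Lip.-lipschitz_(I `*` cO) (fun z => mu D z.1 z.2 a)
    & (forall t x a, I t -> cO x -> A a -> 0 <= rrate D t x a) /\
      (forall t x b, I t -> bO x -> B b -> 0 <= krate D t x b)].

Definition standing_oblique {R : realType} {N Np NA NB : nat}
    (D : problem R N Np NA NB) : Prop :=
  [/\ open (domV D), ctrlB D `<=` domV D,
      Ck_on 1 (boundary (dom D) `*` domV D) (fun z => gamma D z.1 z.2)
    & forall x b, boundary (dom D) x -> ctrlB D b ->
        enorm (gamma D x b) = 1 /\ 0 < dotp (normal D x) (gamma D x b)].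

Definition oblique_projection {R : realType} {N Np NA NB : nat}
    (D : problem R N Np NA NB) : Prop :=
  let bO := boundary (dom D) in
  let tube := [set x | edist x bO < tubeR D] in
  [/\ 0 < tubeR D, 0 < tubed D,
      forall x b, tube x -> ctrlB D b ->
        [/\ bO (projg D x b), - tubed D < distg D x b < tubed D,
            x = projg D x b + distg D x b *: gamma D (projg D x b) b
          & forall y s, bO y -> - tubed D < s < tubed D ->
              x = y + s *: gamma D y b -> y = projg D x b /\ s = distg D x b],
      Ck_on 1 (tube `*` ctrlB D) (fun z => projg D z.1 z.2)
    & Ck_on 1 (tube `*` ctrlB D) (fun z => distg D z.1 z.2)].

Definition standing_assumptions {R : realType} {N Np NA NB : nat}
    (D : problem R N Np NA NB) : Prop :=
  [/\ (1 <= Np <= N)%N, standing_domain D, standing_coefficients D,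
      standing_oblique D & oblique_projection D].

(* [simplices] lists the simplices by their sets of vertices; [chart] maps the
   polyhedral domain onto the closure of the domain and carries each simplex to
   the corresponding element of the exact triangulation; [mproj] is p_h. *)
Record mesh (R : realType) (N : nat) := Mesh {
  vidx : finType;
  vtx : vidx -> 'rV[R]_N;
  simplices : {set {set vidx}};
  chart : 'rV[R]_N -> 'rV[R]_N;
  mproj : 'rV[R]_N -> 'rV[R]_N;
  nodal : vidx -> 'rV[R]_N -> R
}.
Arguments vtx {R N} m _.
Arguments simplices {R N} m.
Arguments nodal {R N} m _ _.

Definition barycentric {R : realType} {I : finType} (K : {set I}) (lam : I -> R)
    : Prop :=
  [/\ forall i, 0 <= lam i, forall i, i \notin K -> lam i = 0
    & \sum_i lam i = 1].

Definition hull {R : realType} {N : nat} (M : mesh R N) (K : {set vidx M})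
    : set 'rV[R]_N :=
  [set \sum_i lam i *: vtx M i | lam in barycentric K].

Definition polyhedron {R : realType} {N : nat} (M : mesh R N) : set 'rV[R]_N :=
  \bigcup_(K in [set` simplices M]) hull K.

Definition exact_element {R : realType} {N : nat} (M : mesh R N)
    (K : {set vidx M}) : set 'rV[R]_N := chart M @` hull K.

Definition meshsize {R : realType} {N : nat} (M : mesh R N) : R :=
  \big[Num.max/0]_(K in simplices M) ediam (hull K).

Definition simplicial_triangulation {R : realType} {N : nat} (M : mesh R N)
    : Prop :=
  [/\ injective (vtx M),
      forall i, exists2 K, K \in simplices M & i \in K,
      forall K, K \in simplices M -> #|K| = N.+1,
      forall K, K \in simplices M -> forall lam : vidx M -> R,
        \sum_(i in K) lam i = 0 -> \sum_(i in K) lam i *: vtx M i = 0 ->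
        forall i, i \in K -> lam i = 0
    & forall K K', K \in simplices M -> K' \in simplices M ->
        hull K `&` hull K' = hull (K :&: K')].

(* An element none of whose vertices lies on the boundary of O is not curved. *)
Definition exact_triangulation {R : realType} {N : nat} (O : set 'rV[R]_N)
    (M : mesh R N) : Prop :=
  [/\ {within polyhedron M, continuous (chart M)},
      {in polyhedron M &, injective (chart M)},
      chart M @` polyhedron M = closure O,
      forall i, chart M (vtx M i) = vtx M i
    & forall K, K \in simplices M -> (forall i, i \in K -> O (vtx M i)) ->
        exact_element K = hull K].

Definition element_projection {R : realType} {N : nat} (M : mesh R N) : Prop :=
  (forall K, K \in simplices M ->
     forall x, exact_element K x -> hull K (mproj M x)) /\
  (forall i, mproj M (vtx M i) = vtx M i).

Definition nodal_basis {R : realType} {N : nat} (M : mesh R N) : Prop :=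
  forall j : vidx M,
  [/\ {within polyhedron M, continuous (nodal M j)},
      forall K, K \in simplices M -> forall lam, barycentric K lam ->
        nodal M j (\sum_i lam i *: vtx M i) =
        \sum_i lam i * nodal M j (vtx M i)
    & forall i, nodal M j (vtx M i) = (i == j)%:R].

Definition admissible_mesh {R : realType} {N : nat} (O : set 'rV[R]_N)
    (M : mesh R N) : Prop :=
  [/\ forall i, closure O (vtx M i), simplicial_triangulation M,
      exact_triangulation O M, element_projection M & nodal_basis M].

Definition interp {R : realType} {N : nat} (M : mesh R N) (V : vidx M -> R)
    (x : 'rV[R]_N) : R :=
  \sum_j nodal M j (mproj M x) * V j.

Definition mesh_family {R : realType} {N : nat} (O : set 'rV[R]_N) {L : Type}
    (M : L -> mesh R N) : Prop :=
  [/\ forall l, admissible_mesh O (M l),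
      exists kappa : R, forall l K, K \in simplices (M l) ->
        ediam (hull K) <= kappa * inradius (hull K)
    & exists C : R, forall l phi, C2_closure O phi ->
        forall x, closure O x ->
        `|interp (fun i => phi (vtx (M l) i)) x - phi x| <=
          C * C2norm O phi * meshsize (M l) ^+ 2].

Definition dt {R : realType} {N Np NA NB : nat} (D : problem R N Np NA NB)
    (NT : nat) : R := horizon D / NT%:R.

Definition tgrid {R : realType} {N Np NA NB : nat} (D : problem R N Np NA NB)
    (NT n : nat) : R := n%:R * dt D NT.

(* The P = 2^Np elements of {-1, 1}^Np, indexed by the boolean functions. *)
Definition xi {R : realType} {Np : nat} (s : {ffun 'I_Np -> bool}) : 'rV[R]_Np :=
  \row_j (-1) ^+ s j.

(* Vectors are rows, so the product of sigma with xi is xi *m sigma^T. *)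
Definition Xstar {R : realType} {N Np NA NB : nat} (D : problem R N Np NA NB)
    (NT n : nat) (x : 'rV[R]_N) (a : 'rV[R]_NA) (s : {ffun 'I_Np -> bool})
    : 'rV[R]_N :=
  x + dt D NT *: mu D (tgrid D NT n) x a
    + Num.sqrt (dt D NT) *: (xi s *m (sigma D (tgrid D NT n) x a)^T).

Definition branch {R : realType} {N Np NA NB : nat} (D : problem R N Np NA NB)
    (M : mesh R N) (NT n : nat) (V : vidx M -> R) (x : 'rV[R]_N)
    (a : 'rV[R]_NA) (b : 'rV[R]_NB) (s : {ffun 'I_Np -> bool}) : R :=
  let X := Xstar D NT n x a s in
  let inside := X \in closure (dom D) in
  let xb := projg D X b in
  let d := if inside then 0 else 2 * distg D X b in
  let k := if inside then 0 else krate D (tgrid D NT n) xb b in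
  let g := if inside then 0 else gcost D (tgrid D NT n) xb b in
  let Xr := if inside then X else X - d *: gamma D xb b in
  expR (- (k * d)) * interp V Xr + d * expR (- (k * d) / 2) * g.

Definition scheme_ab {R : realType} {N Np NA NB : nat}
    (D : problem R N Np NA NB) (M : mesh R N) (NT n : nat) (V : vidx M -> R)
    (i : vidx M) (a : 'rV[R]_NA) (b : 'rV[R]_NB) : R :=
  let x := vtx M i in
  (1 + rrate D (tgrid D NT n) x a * dt D NT)^-1 *
    ((2 ^+ Np)^-1 * \sum_(s : {ffun 'I_Np -> bool}) branch D NT n V x a b s)
  + dt D NT * fcost D (tgrid D NT n) x a.

Definition scheme_int {R : realType} {N Np NA NB : nat}
    (D : problem R N Np NA NB) (M : mesh R N) (NT n : nat) (V : vidx M -> R)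
    (i : vidx M) : R :=
  inf [set scheme_ab D NT n V i c.1 c.2 | c in ctrlA D `*` ctrlB D].

Definition scheme_bd {R : realType} {N Np NA NB : nat}
    (D : problem R N Np NA NB) (M : mesh R N) (ell : R) (NT n : nat)
    (V : vidx M -> R) (i : vidx M) : R :=
  let x := vtx M i in
  inf [set (interp V (x - ell *: gamma D x b) + ell * gcost D (tgrid D NT n) x b)
             / (1 + ell * krate D (tgrid D NT n) x b) | b in ctrlB D].

Definition discrete_solution {R : realType} {N Np NA NB : nat}
    (D : problem R N Np NA NB) (M : mesh R N) (ell : R) (NT : nat)
    (U : nat -> vidx M -> R) : Prop :=
  (forall i, U NT i = Psi D (vtx M i)) /\
  (forall n, (n < NT)%N ->
     (forall i, dom D (vtx M i) -> U n i = scheme_int D NT n (U n.+1) i) /\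
     (forall i, boundary (dom D) (vtx M i) ->
        U n i = scheme_bd D ell NT n (U n) i)).

Definition gridnorm {R : realType} {I : finType} (V : I -> R) : R :=
  \big[Num.max/0]_i `|V i|.

(* Main.v *)
Require Import Defs.
From HB Require Import structures.
From mathcomp Require Import all_boot all_order all_algebra.
From mathcomp Require Import all_classical all_reals all_analysis.
From mathcomp Require Import ring lra.
Import Order.TTheory GRing.Theory Num.Theory.
Import numFieldNormedType.Exports.
Set Implicit Arguments.
Unset Strict Implicit.
Unset Printing Implicit Defensive.
Local Open Scope classical_set_scope.
Local Open Scope ring_scope.

(** The discrete solution is trapped between [- z] and [z], where
      [z n x = K * phi x + C0 + C2 * (T - t_n)]
    and [phi] is a barrier: a function of class C^2 on the whole space whose
    derivative along every oblique direction [gamma D x b] is at least some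
    [c > 0] near the contact point [x].

    A barrier is required because a branch that leaves the domain picks up a
    cost [d * g], where the reflected length [d] is of order [sqrt dt]: summed
    over [T / dt] steps such costs would blow up.  But moving the branch back by
    [d] along the oblique direction lowers [phi] by at least [c * d], so that
    with [K * c >= sup |g|] the decrease of [K * phi] pays for the cost, whatever
    the number of reflections.  What is left of the step is harmless: averaging
    [phi] over the symmetric branches raises it by at most [O(dt)]
    ([average_Xstar]), interpolating it costs [O(h^2)], which is at most
    [O(dt)] as h^2/dt tends to 0, and the running cost is [O(dt)].  A large
    [C2] absorbs all three ([interior_barrier]).  All discount factors are at
    most 1, and interpolation is monotone, so absolute values may be taken
    everywhere and lower and upper bounds are obtained at once.

    On the boundary the equations of one time level are coupled.  At a node
    where [|U| - z] is maximal, and positive, the equation would give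
    [|U i| <= z i + max - K * c * ell + ell * sup |g| + O(h^2)], which is smaller
    than [z i + max = |U i|], because [ell] is comparable to [h] and [h > 0]
    ([boundary_barrier]).

    The barrier is a sum of products of cutoffs with local defining functions of
    the domain.  At a boundary point a defining function vanishes, so only the
    cutoff times its gradient survives; and the gradients of all defining
    functions at a boundary point are positive multiples of the outward normal
    ([defining_function_derive_gt0]).  Hence no partition of unity is involved:
    adding local barriers never spoils the sign, and compactness of the
    boundary gives the global one ([barrier]).  Compactness also makes the
    geometry of the oblique field uniform: small backward steps enter the domain
    ([inward_uniform]) and the oblique distance of a point close to the
    boundary is small ([distg_small]). *)

(** * Calculus of the classes C^k *)

(** The differential of [f] at [x] satisfies the first-order expansion that
    characterizes the differential of [g], since only the values near [x] enter
    that expansion. *)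
Lemma near_eq_differentiable {R : realType} {V W : normedModType R}
    (f g : V -> W) (x : V) :
  (\forall y \near x, f y = g y) -> differentiable f x -> differentiable g x.
Proof.
move=> fg df.
have fgx : f x = g x by exact: nbhs_singleton fg.
have key : g \o shift x = cst (g x) + 'd f x +o_ (0 : V) id.
  apply/eqaddoP => e e0.
  have /eqaddoP/(_ e e0) H := diff_locally df.
  have fg0 : \forall h \near (0 : V), f (h + x) = g (h + x).
    by move: fg; rewrite [in X in X -> _](near_shift 0) subr0.
  apply: filterS2 H fg0 => h + fgh.
  by rewrite !fctE /= fgh fgx.
have dc := diff_continuous df.
have dg := diff_unique dc key.
by apply/diff_locallyP; rewrite dg.
Qed.

Section Ck_calculus.
Variables (R : realType) (V : normedModType R).
Implicit Types (U : set V) (f g : V -> R).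

Lemma Ck0P U f : open U -> Ck 0 U f <-> forall x, U x -> {for x, continuous f}.
Proof.
move=> oU /=; rewrite continuous_open_subspace//; split=> h x.
  by move=> Ux; apply: h; rewrite inE.
by rewrite inE; exact: h.
Qed.

Lemma Ck_differentiable k U f x : Ck k.+1 U f -> U x -> differentiable f x.
Proof. by move=> [h _]; exact: h. Qed.

Lemma Ck_pred k U f : open U -> Ck k.+1 U f -> Ck k U f.
Proof.
move=> oU; elim: k f => [|k IH] f [df Df].
  by apply/Ck0P => // x Ux; exact/differentiable_continuous/df.
by split=> // v; exact/IH/Df.
Qed.

Lemma Ck_continuous k U f x : open U -> Ck k U f -> U x -> {for x, continuous f}.
Proof.
move=> oU; elim: k => [/(Ck0P _ oU)|k IH /(Ck_pred oU)//]; exact.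
Qed.

(** Continuity and differentiability are local, and so is the formation of
    directional derivatives.  This glues functions given by different formulas on
    overlapping open sets, such as a product with a cutoff extended by zero. *)
Lemma Ck_local k U f : open U ->
  (forall x, U x -> exists W g, [/\ open W, W x, Ck k W g
     & forall y, W y -> g y = f y]) -> Ck k U f.
Proof.
move=> oU; elim: k f => [|k IH] f H.
  apply/Ck0P => // x /H[W [g [oW Wx /(Ck0P _ oW) cg gf]]].
  have nW : \forall y \near x, g y = f y.
    by apply: filterS (open_nbhs_nbhs (conj oW Wx)) => y; exact: gf.
  change (f @ x --> f x); apply: (@cvg_trans _ (g @ x)).
    exact: near_eq_cvg.
  by rewrite -(gf _ Wx); exact: cg.
have nW W g x : open W -> W x -> (forall y, W y -> g y = f y) ->
    \forall y \near x, g y = f y.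
  by move=> oW Wx gf; apply: filterS (open_nbhs_nbhs (conj oW Wx)) => y /gf.
split=> [x /H[W [g [oW Wx Cg gf]]]|v].
  exact: near_eq_differentiable (nW _ _ _ oW Wx gf) (Ck_differentiable Cg Wx).
apply: IH => x /H[W [g [oW Wx [_ Dg] gf]]].
exists W, ('D_v g); split=> //; first exact: Dg.
move=> y Wy; apply: near_eq_derive; exact: nW oW Wy gf.
Qed.

Lemma Ck_eq k U f g : open U -> (forall x, U x -> f x = g x) ->
  Ck k U f -> Ck k U g.
Proof. by move=> oU fg Cf; apply: Ck_local => // x Ux; exists U, f. Qed.

Lemma Ck_sub k U W f : open U -> open W -> U `<=` W -> Ck k W f -> Ck k U f.
Proof.
by move=> oU oW UW Cf; apply: Ck_local => // x /UW Wx; exists W, f.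
Qed.

Lemma Ck_cst k U (c : R) : open U -> Ck k U (cst c : V -> R).
Proof.
move=> oU; elim: k c => [|k IH] c; first by apply/Ck0P => // x _; exact: cvg_cst.
split=> // v.
by apply: (Ck_eq oU _ (IH 0)) => x _; rewrite derive_cst.
Qed.

Lemma Ck_add k U f g : open U -> Ck k U f -> Ck k U g ->
  Ck k U (fun x => f x + g x).
Proof.
move=> oU; elim: k f g => [|k IH] f g.
  move=> /(Ck0P _ oU) cf /(Ck0P _ oU) cg; apply/Ck0P => // x Ux.
  by apply: cvgD; [exact: cf|exact: cg].
move=> [df Df] [dg Dg]; split=> [x Ux|v].
  by apply: differentiableD; [exact: df|exact: dg].
apply: (Ck_eq oU _ (IH _ _ (Df v) (Dg v))) => x Ux.
by rewrite [RHS]deriveD//; apply: diff_derivable; [exact: df|exact: dg].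
Qed.

Lemma Ck_mul k U f g : open U -> Ck k U f -> Ck k U g ->
  Ck k U (fun x => f x * g x).
Proof.
move=> oU; elim: k f g => [|k IH] f g.
  move=> /(Ck0P _ oU) cf /(Ck0P _ oU) cg; apply/Ck0P => // x Ux.
  by apply: cvgM; [exact: cf|exact: cg].
move=> Cf Cg; have [df Df] := Cf; have [dg Dg] := Cg; split=> [x Ux|v].
  by apply: differentiableM; [exact: df|exact: dg].
have := Ck_add oU (IH _ _ (Ck_pred oU Cf) (Dg v)) (IH _ _ (Ck_pred oU Cg) (Df v)).
apply: Ck_eq => // x Ux.
by rewrite [RHS]deriveM//; apply: diff_derivable; [exact: df|exact: dg].
Qed.

End Ck_calculus.

(** * Powers of the positive part *)

Lemma cvg_is_derive {R : realType} {V W : normedModType R} (f : V -> W) x v df :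
  (h^-1 *: ((f \o shift x) (h *: v) - f x)) @[h --> (0 : R)^'] --> df ->
  is_derive x v f df.
Proof. by move=> h; split; [apply/cvg_ex; exists df|exact: cvg_lim]. Qed.

Section positive_part_power.
Variable R : realType.

Definition ppow n (t : R) : R := Num.max 0 t ^+ n.

Lemma ppow_ge0 n t : 0 <= ppow n t.
Proof. by rewrite exprn_ge0// le_max lexx. Qed.

Lemma ppow_pos n t : 0 < t -> ppow n t = t ^+ n.
Proof. by move=> t0; rewrite /ppow max_r// ltW. Qed.

Lemma ppow_neg n t : t <= 0 -> ppow n.+1 t = 0.
Proof. by move=> t0; rewrite /ppow max_l// expr0n. Qed.

(** This gives differentiability at the origin, where the difference quotient of
    [ppow n.+2] is [ppow n.+1], a continuous function. *)
Lemma ppowS n t : ppow n.+2 t = t * ppow n.+1 t.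
Proof.
have [t0|t0] := leP t 0; first by rewrite !ppow_neg// mulr0.
by rewrite !ppow_pos// exprS.
Qed.

Lemma ppow_continuous n : continuous (ppow n).
Proof.
move=> t; apply: (@continuous_comp _ _ _ (fun t : R => Num.max 0 t) (fun u => u ^+ n)).
  by apply: continuous_max; [exact: cvg_cst|exact: cvg_id].
exact: exprn_continuous.
Qed.

Lemma is_derive_ppow n t :
  is_derive t (1 : R) (ppow n.+2) (n.+2%:R * ppow n.+1 t).
Proof.
case: (ltgtP t 0) => t0.
- rewrite ppow_neg ?ltW// mulr0.
  apply: near_eq_is_derive (@is_derive_cst R R R 0 t 1).
  near=> s; rewrite ppow_neg//; near: s.
  by apply: filterS (lt_nbhsl t0) => s /ltW.
- have H := @is_deriveX R R id n.+2 t 1 1 (is_derive_id (t : R) (1 : R)).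
  apply: near_eq_is_derive (is_derive_eq H _).
    by near=> s; rewrite ppow_pos ?exprfctE//; near: s; exact: lt_nbhsr.
  by rewrite ppow_pos// /GRing.scale/= mulr1.
- subst t; rewrite ppow_neg// mulr0.
  apply: cvg_is_derive.
  apply: (@cvg_trans _ (ppow n.+1 @ 0^')).
    apply: near_eq_cvg; near=> h.
    rewrite /= addr0 /GRing.scale/= mulr1 [X in _ - X]ppow_neg// subr0 ppowS mulKf//.
    by near: h; exact: nbhs_dnbhs_neq.
  apply: cvg_trans (cvg_app _ (@nbhs_dnbhs _ (0:R))) _.
  rewrite -[X in _ --> X](ppow_neg n (lexx 0)); exact: ppow_continuous.
Unshelve. all: by end_near. Qed.

Lemma derive_comp {V : normedModType R} (g : R -> R) (q : V -> R) x v dg :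
  differentiable q x -> is_derive (q x) (1 : R) g dg ->
  differentiable (g \o q) x /\ 'D_v (g \o q) x = dg * 'D_v q x.
Proof.
move=> dq [gd gE].
have dg' : differentiable g (q x) by exact/derivable1_diffP.
split; first exact: differentiable_comp.
rewrite !deriveE//; last exact: differentiable_comp.
by rewrite diff_comp//= deriv1E// derive1E gE /GRing.scale/= mulrC.
Qed.

(** Each derivative of a truncated power loses one exponent, and the first power
    is still continuous. *)
Lemma Ck_ppow {V : normedModType R} k U (q : V -> R) : open U ->
  Ck k U q -> Ck k U (fun x => ppow k.+1 (q x)).
Proof.
move=> oU; elim: k => [|k IH] Cq.
  apply/Ck0P => // x Ux; apply: continuous_comp.
    by move/(Ck0P _ oU): Cq; exact.
  exact: ppow_continuous.
have [dq Dq] := Cq; split=> [x Ux|v].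
  by have [] := derive_comp 0 (dq _ Ux) (is_derive_ppow k (q x)).
have Cpow := Ck_mul oU (Ck_cst k k.+2%:R oU) (IH (Ck_pred oU Cq)).
apply: (Ck_eq oU) (Ck_mul oU Cpow (Dq v)) => x Ux.
by have [_ ->] := derive_comp v (dq _ Ux) (is_derive_ppow k (q x)).
Qed.

End positive_part_power.

(** * Mean value and Taylor estimates *)

Section segments.
Variables (R : realType) (V : normedModType R).
Implicit Types (f : V -> R) (x v : V).

Lemma is_derive_line f x v t : differentiable f (x + t *: v) ->
  is_derive t (1 : R) (fun s => f (x + s *: v)) ('D_v f (x + t *: v)).
Proof.
move=> df; have [d _] := derivableP (diff_derivable (v := v) df).
apply: cvg_is_derive; move: d; rewrite /derivable => d.
rewrite (_ : (fun h : R => _) = (fun h : R => h^-1 *: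
   ((f \o shift (x + t *: v)) (h *: v) - f (x + t *: v)))) //.
apply/funext => h; rewrite /=.
have -> : h *: (1 : R) = h by rewrite /GRing.scale/= mulr1.
by rewrite scalerDl addrCA.
Qed.

Lemma MVT_line f x v :
  (forall t, 0 <= t <= 1 -> differentiable f (x + t *: v)) ->
  exists2 t, 0 <= t <= 1 & f (x + v) - f x = 'D_v f (x + t *: v).
Proof.
move=> df.
have H (t : R) : t \in `[0, 1] -> is_derive t (1 : R) (fun s => f (x + s *: v))
    ('D_v f (x + t *: v)) by rewrite in_itv/= => t01; exact/is_derive_line/df.
have H1 (t : R) : t \in `]0, 1[ -> is_derive t (1 : R) (fun s => f (x + s *: v))
    ('D_v f (x + t *: v)) by move=> /subset_itv_oo_cc; exact: H.
have H2 : {within `[0, 1], continuous (fun s : R => f (x + s *: v))}.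
  by apply: derivable_within_continuous => t /H[].
have [t t01] := MVT_segment (@ler01 R) H1 H2.
rewrite scale1r scale0r addr0 subr0 mulr1 => E; by exists t.
Qed.

Lemma derive_scale f x v (k : R) : differentiable f x ->
  'D_(k *: v) f x = k * 'D_v f x.
Proof. by move=> df; rewrite !deriveE// linearZ. Qed.

End segments.

Lemma sum_continuous {R : realType} {T : topologicalType} {I : finType}
    (f : I -> T -> R) (x : T) : (forall i, {for x, continuous (f i)}) ->
  {for x, continuous (fun y => \sum_i f i y)}.
Proof.
move=> fc; rewrite (_ : (fun y => _) = \sum_i f i); last first.
  by apply/funext => y; rewrite fct_sumE.
apply: (big_ind (fun g : T -> R => {for x, continuous g})) => //.
  exact: cvg_cst.
by move=> g h gc hc; exact: (@cvgD _ R).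
Qed.

Lemma mx_norm_leP {R : realType} {m n : nat} (v : 'M[R]_(m, n)) (c : R) :
  0 <= c -> `|v| <= c <-> forall i j, `|v i j| <= c.
Proof.
move=> c0; rewrite {1}/Num.norm/= mx_normrE; split.
  by move/bigmax_leP => [_ h] i j; exact: (h (i, j)).
by move=> h; apply/bigmax_leP; split=> // -[i j] _; exact: h.
Qed.

Lemma mx_entry_le {R : realType} {m n : nat} (v : 'M[R]_(m, n)) i j :
  `|v i j| <= `|v|.
Proof. by have /mx_norm_leP := lexx `|v|; exact. Qed.

Lemma compact_bound {R : realType} {T : topologicalType} {V : normedModType R}
    (S : set T) (f : T -> V) : compact S -> {within S, continuous f} ->
  exists2 C, 0 <= C & forall x, S x -> `|f x| <= C.
Proof.
move=> cS fc; have /compact_bounded[M [_ HM]] := continuous_compact fc cS.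
exists `|M + 1|; first exact: normr_ge0.
move=> x Sx; apply: HM; last by exists x.
by rewrite (lt_le_trans _ (ler_norm _))// ltrDl.
Qed.

Section coordinates.
Variables (R : realType) (N : nat).
Local Notation V := 'rV[R]_N.
Implicit Types (f : V -> R) (x v : V).

Lemma derive_partial f x v : differentiable f x ->
  'D_v f x = \sum_i v 0 i * partial i f x.
Proof.
move=> df; rewrite deriveE// {1}(row_sum_delta v) linear_sum.
by apply: eq_bigr => i _; rewrite linearZ /partial deriveE.
Qed.

Lemma derive_dotp f x v : differentiable f x -> 'D_v f x = dotp (grad f x) v.
Proof.
move=> df; rewrite derive_partial//.
by apply: eq_bigr => i _; rewrite mxE mulrC.
Qed.

Lemma row_entry_le v i : `|v 0 i| <= `|v|.
Proof. exact: mx_entry_le. Qed.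

Lemma derive_le f x v : differentiable f x ->
  `|'D_v f x| <= `|v| * \sum_i `|partial i f x|.
Proof.
move=> df; rewrite derive_partial// mulr_sumr.
apply: (le_trans (ler_norm_sum _ _ _)); apply: ler_sum => i _.
by rewrite normrM ler_wpM2r// row_entry_le.
Qed.

(** Two applications of the mean value theorem, the second one to ['D_v f],
    express the remainder through a second derivative of [f] in the direction [v]
    at a point of the segment; this is a quadratic form in [v] whose coefficients
    are bounded on the compact set [Q]. *)
Lemma taylor_bound f (Q : set V) : Ck 2 setT f -> compact Q ->
  exists2 C, 0 <= C & forall x v,
    (forall t, 0 <= t <= 1 -> Q (x + t *: v)) ->
    `|f (x + v) - f x - 'D_v f x| <= C * `|v| ^+ 2.
Proof.
move=> [df Df] cQ.
pose h := fun x => \sum_i \sum_j `|partial j (partial i f) x|.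
have hc : continuous h.
  move=> x; apply: sum_continuous => i; apply: sum_continuous => j.
  have [_ /(_ (delta_mx 0 j))/(Ck0P _ openT)/(_ x Logic.I) pc] := Df (delta_mx 0 i).
  exact: (cvg_norm pc).
have [C C0 hC'] := compact_bound cQ (continuous_subspaceT hc).
have hC x : Q x -> h x <= C by move=> /hC'; exact/le_trans/ler_norm.
exists C => // x v Qxv.
have [t /andP[t0 t1] ->] := @MVT_line _ _ f x v (fun t _ => df _ Logic.I).
have dDf w y : differentiable ('D_w f) y by have [d _] := Df w; exact: d.
have [s /andP[s0 s1] ->] := @MVT_line _ _ ('D_v f) x (t *: v) (fun s _ => dDf v _).
set y := _ + _.
have Qy : Q y.
  by rewrite /y scalerA; apply: Qxv; rewrite mulr_ge0// mulr_ile1.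
rewrite derive_scale// normrM (ger0_norm t0).
apply: (@le_trans _ _ `|'D_v ('D_v f) y|); first by rewrite ler_piMl.
have -> : 'D_v f = \sum_i (v 0 i *: partial i f).
  apply/funext => z; rewrite derive_partial; last exact: df.
  by rewrite fct_sumE.
rewrite derive_sum; last by move=> i; exact/derivableZ/diff_derivable/dDf.
apply: (@le_trans _ _ (`|v| ^+ 2 * h y)); last by rewrite mulrC ler_wpM2r// hC.
apply: (le_trans (ler_norm_sum _ _ _)); rewrite /h mulr_sumr.
apply: ler_sum => i _; rewrite deriveZ; last exact/diff_derivable/dDf.
rewrite normrZ expr2 -mulrA ler_pM// ?row_entry_le//.
exact/derive_le/dDf.
Qed.
End coordinates.

(** * Domains, boundaries and norms *)

Section topology_of_domains.
Variables (R : realType) (N : nat).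
Local Notation V := 'rV[R]_N.
Implicit Types (O : set V).

Lemma boundaryE O x : open O -> boundary O x <-> closure O x /\ ~ O x.
Proof. by move=> /interior_id oO; rewrite /boundary oO. Qed.

Lemma closure_dom_or_boundary O x : open O -> closure O x -> O x \/ boundary O x.
Proof.
by move=> oO cx; have [|nO] := pselect (O x); [left|right; apply/boundaryE].
Qed.

Lemma compact_closure O : bounded_set O -> compact (closure O).
Proof.
move=> [M [Mr HM]]; apply: bounded_closed_compact; last exact: closed_closure.
exists (M + 1); split; first by rewrite realD.
move=> m Mm x cx; apply/ler_addgt0Pr => e e0.
have [y [Oy]] := cx _ (nbhsx_ballx x e e0).
rewrite -ball_normE/= => xy.
rewrite -(subrK y x) (le_trans (ler_normD _ _))// addrC lerD//; last exact: ltW.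
by apply: (HM m) => //; rewrite (lt_trans _ Mm)// ltrDl.
Qed.

Lemma compact_boundary O : open O -> bounded_set O -> compact (boundary O).
Proof.
move=> oO bO; apply: (@subclosed_compact _ _ (closure O)).
- rewrite /boundary; apply: closedI; first exact: closed_closure.
  by apply: open_closedC; exact: open_interior.
- exact: compact_closure.
- by move=> x [].
Qed.

(** Otherwise the parameters of the points of the segment in [O] would form a
    subset of the unit interval that is both open and closed. *)
Lemma segment_meets_boundary O x y : open O -> O x -> ~ closure O y ->
  exists2 t, 0 <= t <= 1 & boundary O (x + t *: (y - x)).
Proof.
move=> oO Ox nOy; apply: contrapT => nb.
pose f (t : R) := x + t *: (y - x).
have fc : continuous f.
  by move=> t; apply: cvgD; [exact: cvg_cst|apply: cvgZr_tmp; exact: cvg_id].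
have : [set` `[(0 : R), 1]] `&` (f @^-1` O) = [set` `[(0 : R), 1]].
  have := @segment_connected R 0 1; apply.
  - by exists 0; split; rewrite /= ?in_itv/= ?lexx ?ler01// /f scale0r addr0.
  - by exists (f @^-1` O) => //; apply: open_comp => // t _; exact: fc.
  - exists (f @^-1` closure O).
      by apply: closed_comp => [t _|]; [exact: fc|exact: closed_closure].
    apply/seteqP; split=> t [t01 Ot]; split=> //; first exact: subset_closure.
    have [//|bt] := closure_dom_or_boundary oO Ot.
    by exfalso; apply: nb; exists t => //; rewrite /= in_itv in t01.
move/seteqP => [_ /(_ 1)]; rewrite /= in_itv/= ler01 lexx => /(_ isT)[_].
rewrite /f scale1r addrC subrK => /subset_closure; exact: nOy.
Qed.

End topology_of_domains.

Section euclidean.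
Variables (R : realType) (N : nat).
Implicit Types u v : 'rV[R]_N.

Lemma dotpZl (k : R) u v : dotp (k *: u) v = k * dotp u v.
Proof.
by rewrite /dotp mulr_sumr; apply: eq_bigr => i _; rewrite mxE mulrA.
Qed.

Lemma dotp_ge0 u : 0 <= dotp u u.
Proof. by apply: sumr_ge0 => i _; rewrite -expr2 sqr_ge0. Qed.

Lemma dotp_gt0 u : u != 0 -> 0 < dotp u u.
Proof.
move=> u0; rewrite lt_neqAle dotp_ge0 andbT; apply: contra u0 => /eqP/esym/eqP.
rewrite psumr_eq0 => [/allP h|i _]; last by rewrite -expr2 sqr_ge0.
apply/eqP/rowP => i; rewrite mxE; apply/eqP.
by have := h i (mem_index_enum _); rewrite mulf_eq0 orbb.
Qed.

Lemma entry_sqr_le_dotp u i : u 0 i ^+ 2 <= dotp u u.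
Proof.
rewrite /dotp (bigD1 i)//= expr2 lerDl; apply: sumr_ge0 => j _.
by rewrite -expr2 sqr_ge0.
Qed.

Lemma norm_le_enorm u : `|u| <= enorm u.
Proof.
apply/mx_norm_leP => [|i j]; first exact: sqrtr_ge0.
rewrite (ord1 i) -(sqrtr_sqr (u 0 j)) ler_wsqrtr//.
exact: entry_sqr_le_dotp.
Qed.

Lemma enorm_le_norm u : enorm u <= N%:R * `|u|.
Proof.
have H : 0 <= N%:R * `|u| by rewrite mulr_ge0.
rewrite /enorm -(ger0_norm H) -sqrtr_sqr ler_wsqrtr// exprMn.
apply: (@le_trans _ _ (\sum_(i < N) `|u| ^+ 2)).
  apply: ler_sum => i _; rewrite -expr2 -[leLHS]ger0_norm ?sqr_ge0//.
  by rewrite normrX lerXn2r ?nnegrE// row_entry_le.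
rewrite sumr_const card_ord -[leLHS]mulr_natl ler_wpM2r ?sqr_ge0//.
case: N => [|n]; first by rewrite expr0n.
by rewrite -natrX ler_nat leq_pmull.
Qed.

End euclidean.

Section C2_closure_global.
Variables (R : realType) (N : nat).
Local Notation V := 'rV[R]_N.

Lemma Ck_ext_of_Ck k (U : set V) (f : V -> R) : Ck k setT f -> Ck_ext k U f.
Proof.
have cl g : Ck 0 setT g -> exists F : V -> R,
    {within closure U, continuous F} /\ forall x, U x -> F x = g x.
  move=> /(Ck0P _ openT) cg; exists g; split=> //.
  by apply: continuous_subspaceT => x; exact: cg.
elim: k f => [|k IH] f Cf; first by split=> //; exact: cl.
split; last first.
  have [df Df] := Cf; split=> [x _|v]; first exact: df.
  exact/IH/Df.
apply: cl; apply/Ck0P; first exact: openT.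
by move=> x _; apply: (Ck_continuous openT Cf).
Qed.

Lemma C2_closure_of_Ck (U : set V) (f : V -> R) : Ck 2 setT f -> C2_closure U f.
Proof.
move=> Cf; split; last exact: Ck_ext_of_Ck.
apply: continuous_subspaceT => x.
exact: (Ck_continuous openT Cf).
Qed.

End C2_closure_global.

(** * Gradients of defining functions *)

Section defining_functions.
Variables (R : realType) (N : nat).
Local Notation V := 'rV[R]_N.
Implicit Types (O W : set V) (phi : V -> R) (x v : V).

Lemma defining_function_move k O x0 x W phi :
  defining_function k O x0 W phi -> W x -> defining_function k O x W phi.
Proof. by move=> []. Qed.

Lemma defining_function_pred k O x W phi :
  defining_function k.+1 O x W phi -> defining_function k O x W phi.
Proof. by move=> [oW Wx C H1 H2]; split=> //; exact: Ck_pred. Qed.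

(** A boundary point is not in the open set, so the function is nonnegative
    there; were it positive, it would be positive on a neighborhood, which would
    then miss the set. *)
Lemma defining_function_boundary k O x W phi : open O ->
  defining_function k O x W phi -> boundary O x -> phi x = 0.
Proof.
move=> oO [oW Wx C HO _] /(boundaryE _ oO)[cx nOx].
apply/eqP; rewrite eq_le; apply/andP; split; rewrite leNgt; apply/negP => H.
  have cphi := Ck_continuous oW C Wx.
  have nW : \forall y \near x, W y by exact: open_nbhs_nbhs.
  have npos : \forall y \near x, 0 < phi y by exact: (cvgr_gt _ cphi).
  have [y [Oy [Wy]]] := cx _ (filterI nW npos).
  by rewrite ltNge => /negP; apply; exact/ltW/HO.
exact/nOx/HO.
Qed.

Lemma derive_gt0_lt0 phi x v : differentiable phi x -> phi x = 0 ->
  0 < 'D_v phi x -> \forall s \near (0 : R)^'+, phi (x - s *: v) < 0.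
Proof.
move=> dphi phi0 D0.
have H : h^-1 *: ((phi \o shift x) (h *: v) - phi x) @[h --> (0 : R)^'] --> 'D_v phi x.
  exact: (diff_derivable (v := v) dphi).
have nH : nbhs (0 : R) (fun h => h != 0 ->
  0 < h^-1 *: ((phi \o shift x) (h *: v) - phi x)) by exact: cvgr_gt H _ D0.
have [e /= e0 He] := (nbhs_ballP _ _).1 nH.
near=> s.
have s0 : 0 < s by near: s; exact: nbhs_right_gt.
have := He (- s); rewrite /= phi0 subr0 scaleNr [- _ + x]addrC.
rewrite -ball_normE/= sub0r opprK gtr0_norm// oppr_eq0 gt_eqF//.
have -> : s < e by near: s; exact: nbhs_right_lt.
by move=> /(_ isT isT); rewrite /GRing.scale/= invrN mulNr oppr_gt0 pmulr_rlt0// invr_gt0.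
Unshelve. all: by end_near. Qed.

(** Moving from [x] against a direction [u] with ['D_u psi x > 0] enters [O],
    where [phi] is negative; thus ['D_u phi x >= 0].  Strictness comes from
    perturbing [v] to [u := v - e *: grad phi x], which for small [e] still has a
    positive derivative of [psi], while the perturbation itself contributes
    [e * |grad phi x|^2 > 0] to the derivative of [phi]. *)
Lemma defining_function_derive_gt0 O x (W W' : set V) phi psi v :
  open O -> boundary O x -> defining_function 1 O x W phi ->
  defining_function 1 O x W' psi -> 0 < 'D_v psi x -> 0 < 'D_v phi x.
Proof.
move=> oO bx dphi dpsi D0.
have phi0 := defining_function_boundary oO dphi bx.
have psi0 := defining_function_boundary oO dpsi bx.
have [oW Wx [dfphi _] Ophi gphi] := dphi.
have [oW' W'x [dfpsi _] Opsi _] := dpsi.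
have {}dfphi := dfphi x Wx; have {}dfpsi := dfpsi x W'x.
set a := grad phi x.
have a0 : 0 < 'D_a phi x by rewrite derive_dotp//; exact/dotp_gt0/gphi.
have [e e0 De] : exists2 e : R, 0 < e & 0 < 'D_(v - e *: a) psi x.
  exists ('D_v psi x / (2 * (1 + `|'D_a psi x|))).
    by rewrite divr_gt0// mulr_gt0// ltr_wpDr.
  rewrite deriveE// linearB linearZ/= -!deriveE// subr_gt0.
  set p := 'D_v psi x in D0 *; set q := 'D_a psi x.
  rewrite -[X in X < _]/(_ * _) -mulrA gtr_pMr// mulrC ltr_pdivrMr ?mul1r; last first.
    by rewrite mulr_gt0// ltr_wpDr.
  by apply: (le_lt_trans (ler_norm q)); have := normr_ge0 q; lra.
set u := v - e *: a in De *.
suff H : 0 <= 'D_u phi x.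
  have : 'D_v phi x = 'D_u phi x + e * 'D_a phi x.
    by rewrite /u !deriveE// linearB linearZ/= subrK.
  by move=> ->; rewrite ltr_wpDl// mulr_gt0.
rewrite leNgt; apply/negP => Du.
have nphi := derive_gt0_lt0 (differentiableN dfphi).
have := nphi u; rewrite [in X in X -> _]deriveN; last exact: diff_derivable.
rewrite fctE phi0 oppr0 oppr_gt0 => /(_ erefl Du) {}nphi.
have npsi := derive_gt0_lt0 dfpsi psi0 De.
have cx : (x - s *: u) @[s --> (0 : R)^'+] --> x.
  apply: cvg_at_right_filter; rewrite -[X in _ --> X]subr0 -[X in _ - X](scale0r u).
  by apply: cvgB; [exact: cvg_cst|apply: cvgZr_tmp; exact: cvg_id].
have nW : \forall s \near (0 : R)^'+, W (x - s *: u).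
  by apply: cx; exact: open_nbhs_nbhs.
have nW' : \forall s \near (0 : R)^'+, W' (x - s *: u).
  by apply: cx; exact: open_nbhs_nbhs.
have [s [[[Ws W's] ns] ps]] := filter_ex (filterI (filterI (filterI nW nW') nphi) npsi).
move: ns; rewrite oppr_lt0; apply/negP; rewrite -leNgt; apply/ltW.
exact/(Ophi _ Ws)/(Opsi _ W's).
Qed.

Lemma outward_normal_derive_gt0 O x (W : set V) phi v n :
  open O -> boundary O x -> defining_function 1 O x W phi ->
  is_outward_normal O x n -> 0 < dotp n v -> 0 < 'D_v phi x.
Proof.
move=> oO bx dphi [W' [psi [dpsi ->]]]; rewrite dotpZl => H.
apply: (defining_function_derive_gt0 oO bx dphi dpsi).
have [_ W'x [dfpsi _] _ _] := dpsi; rewrite derive_dotp; last exact: dfpsi.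
by move: H; apply: contraTT; rewrite -!leNgt => H; rewrite mulr_ge0_le0// invr_ge0 sqrtr_ge0.
Qed.

(** Joint continuity of the derivative in the base point and the direction. *)
Lemma derive_gt_near (W : set V) phi x0 v0 (c : R) : open W -> Ck 1 W phi -> W x0 ->
  c < 'D_v0 phi x0 -> exists2 e, 0 < e &
    forall y v, `|y - x0| < e -> `|v - v0| < e -> W y /\ c < 'D_v phi y.
Proof.
move=> oW [dphi Dphi] Wx0; rewrite derive_partial; last exact: dphi.
pose F (z : V * V) := \sum_i z.2 0 i * partial i phi z.1.
rewrite -/(F (x0, v0)) => cF.
have Fc : {for (x0, v0), continuous F}.
  apply: sum_continuous => i.
  apply: (@cvgM _ _ _ _ (fun z : V * V => z.2 0 i) (fun z => partial i phi z.1)).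
    apply: (@continuous_comp _ _ _ snd (fun v : V => v 0 i)); first exact: cvg_snd.
    exact: coord_continuous.
  apply: (@continuous_comp _ _ _ fst (partial i phi)); first exact: cvg_fst.
  by move: (Dphi (delta_mx 0 i)) => /(Ck0P _ oW); exact.
have n1 : \forall z \near (x0, v0), c < F z by exact: (cvgr_gt _ Fc).
have n2 : \forall z \near (x0, v0), W z.1.
  by apply: (@cvg_fst V V (nbhs x0) (nbhs v0)); exact: open_nbhs_nbhs.
have [e /= e0 He] := (nbhs_ballP _ _).1 (filterI n2 n1).
exists e => // y v yx vv0.
have [|Wy Fy] := He (y, v); first by split; rewrite -ball_normE/= distrC.
by split=> //; rewrite derive_partial//; exact: dphi.
Qed.

End defining_functions.

(** * Uniform geometry of the oblique field *)

Lemma Ck_on_near {R : realType} {V W : normedModType R} k (S : set V)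
    (f : V -> W) z (e : R) : Ck_on k.+1 S f -> S z -> 0 < e ->
  \forall z' \near z, S z' -> `|f z' - f z| < e.
Proof.
move=> Cf Sz e0; have [U [F [oU Uz [dF _] Ff]]] := Cf z Sz.
have Fc : F @ z --> F z by exact/differentiable_continuous/dF.
have n1 : \forall z' \near z, `|F z - F z'| < e by move/cvgrPdist_lt: Fc; exact.
have n2 : \forall z' \near z, U z' by exact: open_nbhs_nbhs.
by apply: filterS2 n1 n2 => z' + Uz' Sz'; rewrite !Ff// distrC.
Qed.

Section oblique_geometry.
Variables (R : realType) (N Np NA NB : nat) (D : problem R N Np NA NB).
Hypothesis HD : standing_assumptions D.
Local Notation O := (dom D).
Local Notation bO := (boundary (dom D)).
Local Notation B := (ctrlB D).
Local Notation V := 'rV[R]_N.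

Let oO : open O.
Proof. by have [_ [_ [? _ _ _] _ _]] := HD. Qed.

Let bdO : bounded_set O.
Proof. by have [_ [_ [_ _ _ ?] _ _]] := HD. Qed.

Lemma compact_contact : compact (bO `*` B).
Proof.
have [_ _ [[_ _ _ cB] _ _ _ _] _ _] := HD.
by apply: compact_setX => //; exact: compact_boundary.
Qed.

Lemma gamma_near x b (e : R) : bO x -> B b -> 0 < e ->
  \forall z \near (x, b), bO z.1 -> B z.2 ->
    `|gamma D z.1 z.2 - gamma D x b| < e.
Proof.
move=> bx Bb e0; have [_ _ _ [_ BV gC1 _] _] := HD.
have := Ck_on_near gC1 (conj bx (BV _ Bb) : (bO `*` domV D) (x, b)) e0.
by apply: filterS => -[y c]/= H by_ Bc; apply: H; split => //; exact: BV.
Qed.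

Lemma norm_gamma_le1 x b : bO x -> B b -> `|gamma D x b| <= 1.
Proof.
move=> bx Bb; have [_ _ _ [_ _ _ /(_ x b bx Bb)[<- _]] _] := HD.
exact: norm_le_enorm.
Qed.

Lemma oblique_derive_gt0 x b W phi : bO x -> B b ->
  defining_function 1 O x W phi -> 0 < 'D_(gamma D x b) phi x.
Proof.
move=> bx Bb dphi; have [_ [_ _ _ nx] _ [_ _ _ /(_ x b bx Bb)[_ ng]] _] := HD.
exact: outward_normal_derive_gt0 oO bx dphi (nx x bx) ng.
Qed.

(** By the mean value theorem a defining function decreases from 0 along
    [- gamma D x b], because its derivative along the oblique field stays positive
    in a neighborhood of the contact point; the step size is made uniform by
    compactness of the set of pairs (contact point, control). *)
Lemma inward_uniform : exists2 s0 : R, 0 < s0 &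
  forall x b s, bO x -> B b -> 0 < s <= s0 -> O (x - s *: gamma D x b).
Proof.
pose P (s : R) (z : V * 'rV[R]_NB) :=
  bO z.1 -> B z.2 -> O (z.1 - s *: gamma D z.1 z.2).
have H : \forall s \near (0 : R)^'+, (bO `*` B) `<=` P s.
  have /compact_near_coveringP := compact_contact; apply => -[x0 b0] [/= bx0 Bb0].
  have [_ [_ _ /(_ x0 bx0)[W [phi dphi3]] _] _ _ _] := HD.
  have dphi : defining_function 1 O x0 W phi.
    by do 2 apply: defining_function_pred.
  have [oW Wx0 C1 Ophi _] := dphi.
  have D0 := oblique_derive_gt0 bx0 Bb0 dphi.
  have [e e0 He] := derive_gt_near oW C1 Wx0 D0.
  have e20 : 0 < e / 2 by rewrite divr_gt0.
  have n1 : \forall z \near (x0, b0), `|z.1 - x0| < e / 2.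
    by apply: filterS (nbhsx_ballx (x0, b0) _ e20) => z []; rewrite -ball_normE/= distrC.
  have n2 := gamma_near bx0 Bb0 e0.
  near=> z s; rewrite /P/= => bz Bz.
  have s0 : 0 < s by near: s; exact: nbhs_right_gt.
  have se : s < e / 2 by near: s; exact: nbhs_right_lt.
  have zx : `|z.1 - x0| < e / 2 by near: z.
  have gz : `|gamma D z.1 z.2 - gamma D x0 b0| < e.
    by move: bz Bz; near: z; exact: n2.
  have near_x0 t : 0 <= t <= 1 ->
      `|z.1 + t *: (- s *: gamma D z.1 z.2) - x0| < e.
    move=> /andP[t0 t1].
    rewrite addrAC (le_lt_trans (ler_normD _ _))// (splitr e) ltr_leD// scalerA normrZ.
    rewrite mulrN normrN normrM !ger0_norm// ?(ltW s0)//.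
    apply: (le_trans _ (ltW se)); rewrite -[leRHS]mulr1 ler_pM ?mulr_ge0 ?(ltW s0)//.
      by rewrite ler_piMl// ltW.
    exact: norm_gamma_le1.
  have [Wz _] : W z.1 /\ 0 < 'D_(gamma D z.1 z.2) phi z.1.
    by apply: He => //; rewrite (lt_trans zx)// ltr_pdivrMr// ltr_pMr// ltr1n.
  rewrite -scaleNr; have [_ _ [dph _] _ _] := dphi.
  have [t t01] : exists2 t, 0 <= t <= 1 &
      phi (z.1 + (- s *: gamma D z.1 z.2)) - phi z.1 =
      'D_(- s *: gamma D z.1 z.2) phi (z.1 + t *: (- s *: gamma D z.1 z.2)).
    by apply: MVT_line => t t01; apply: dph; have [] := He _ _ (near_x0 t t01) gz.
  have [Wy Dy] := He _ _ (near_x0 t t01) gz.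
  rewrite derive_scale; last exact: dph.
  rewrite (defining_function_boundary oO (defining_function_move dphi Wz) bz) subr0 => E.
  have [W1 _] := He _ _ (near_x0 1 (introT andP (conj ler01 (lexx 1)))) gz.
  rewrite scale1r in W1; apply/Ophi => //.
  by rewrite E mulNr oppr_lt0 mulr_gt0.
have [e /= e0 He] := (nbhs_ballP _ _).1 (H : nbhs (0 : R) (fun s => 0 < s -> _)).
exists (e / 2); first by rewrite divr_gt0.
move=> x b s bx Bb /andP[s0 se].
have := He s; rewrite -ball_normE/= sub0r normrN gtr0_norm//.
have -> : s < e by rewrite (le_lt_trans se)// ltr_pdivrMr// ltr_pMr// ltr1n.
by move=> /(_ isT s0 (x, b)) /(_ (conj bx Bb)); exact.
Unshelve. all: by end_near. Qed.

(** The oblique distance vanishes on the boundary, by uniqueness of the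
    decomposition of a point of the tube, and it is continuous; compactness makes
    its smallness near the boundary uniform. *)
Lemma distg_small (e : R) : 0 < e -> exists2 eta : R, 0 < eta &
  forall x b X, bO x -> B b -> `|X - x| < eta ->
    Defs.edist X bO < tubeR D /\ `|distg D X b| < e.
Proof.
move=> e0; have [_ _ _ _ [tR td Hproj _ Cdist]] := HD.
have edist_lt x X r : bO x -> enorm (X - x) < r -> Defs.edist X bO < r.
  move=> bx; apply: le_lt_trans; apply: ge_inf; last by exists x.
  by exists 0 => _ [y _ <-]; exact: sqrtr_ge0.
have enorm0 : enorm (0 : V) = 0.
  by apply/le_anti; rewrite sqrtr_ge0 andbT (le_trans (enorm_le_norm _))// normr0 mulr0.
have dist0 x b : bO x -> B b -> Defs.edist x bO < tubeR D /\ distg D x b = 0.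
  move=> bx Bb; have tx : Defs.edist x bO < tubeR D.
    by apply: (edist_lt x) => //; rewrite subrr enorm0.
  split=> //; have [_ _ _ /(_ x 0 bx)[]] := Hproj x b tx Bb => //.
    by rewrite oppr_lt0 td.
  by rewrite scale0r addr0.
pose S : set (V * 'rV[R]_NB) := [set x | Defs.edist x bO < tubeR D] `*` B.
pose P (s : R) (z : V * 'rV[R]_NB) :=
  bO z.1 -> B z.2 -> forall X, `|X - z.1| < s -> Defs.edist X bO < tubeR D ->
    `|distg D X z.2| < e.
have H : \forall s \near (0 : R)^'+, (bO `*` B) `<=` P s.
  have /compact_near_coveringP := compact_contact; apply => -[x0 b0] [/= bx0 Bb0].
  have [t0 d0] := dist0 _ _ bx0 Bb0.
  have n := Ck_on_near Cdist (conj t0 Bb0 : S (x0, b0)) e0.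
  have [r /= r0 Hr] := (nbhs_ballP _ _).1 n.
  have r20 : 0 < r / 2 by rewrite divr_gt0.
  have n1 : \forall z \near (x0, b0), ball (x0, b0) (r / 2) z by exact: nbhsx_ballx.
  near=> z s; rewrite /P/= => bz Bz X Xz tX.
  have sr : s < r / 2 by near: s; exact: nbhs_right_lt.
  have [z1 z2] : ball (x0, b0) (r / 2) z by near: z.
  have := Hr (X, z.2); rewrite /= d0 subr0; apply=> //; split=> /=.
    move: z1; rewrite -!ball_normE/= => z1.
    rewrite (splitr r) -(subrKA z.1) (le_lt_trans (ler_normD _ _))// ltrD//.
    by rewrite distrC (lt_trans Xz).
  by apply: le_ball z2; rewrite ler_pdivrMr// ler_pMr// ler1n.
have [r /= r0 Hr] := (nbhs_ballP _ _).1 (H : nbhs (0 : R) (fun s => 0 < s -> _)).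
pose eta := Num.min (r / 2) (tubeR D / (N%:R + 1)).
have eta0 : 0 < eta by rewrite lt_min !divr_gt0// ltr_wpDl.
exists eta => // x b X bx Bb Xx.
have tX : Defs.edist X bO < tubeR D.
  apply: (edist_lt x) => //; apply: (le_lt_trans (enorm_le_norm _)).
  apply: (@le_lt_trans _ _ (N%:R * eta)); first by rewrite ler_wpM2l// ltW.
  apply: (@lt_le_trans _ _ ((N%:R + 1) * eta)); first by rewrite ltr_pM2r// ltrDl.
  by rewrite mulrC -ler_pdivlMr ?ltr_wpDl// ge_min lexx orbT.
split=> //; have := Hr eta; rewrite -ball_normE/= sub0r normrN gtr0_norm//.
have -> : eta < r.
  have : eta <= r / 2 by rewrite ge_min lexx.
  by move/le_lt_trans; apply; rewrite ltr_pdivrMr// ltr_pMr// ltr1n.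
by move=> /(_ isT eta0 (x, b) (conj bx Bb)); apply.
Unshelve. all: by end_near. Qed.

End oblique_geometry.

(** * Construction of the barrier *)

Section bump.
Variables (R : realType) (N : nat).
Local Notation V := 'rV[R]_N.

Lemma Ck_coord k (U : set V) i : open U -> Ck k U (fun x : V => x 0 i).
Proof.
move=> oU; case: k => [|k].
  by apply/Ck0P => // x _; exact: coord_continuous.
split=> [x _|v]; first exact: differentiable_coord.
apply: (Ck_eq oU _ (Ck_cst k (v 0 i) oU)) => x _.
rewrite deriveE; last exact: differentiable_coord.
have L : linear (fun x : V => x 0 i : R) by move=> a u w; rewrite !mxE.
pose l := GRing.isLinear.Build _ _ _ _ _ L.
pose f : {linear V -> R} := HB.pack (fun x : V => x 0 i : R) l.
have fc : continuous f by exact: coord_continuous.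
by rewrite [RHS](_ : _ = 'd f x v)// diff_lin.
Qed.

Lemma Ck_sum k (U : set V) (I : finType) (f : I -> V -> R) : open U ->
  (forall i, Ck k U (f i)) -> Ck k U (fun x => \sum_i f i x).
Proof.
move=> oU Cf; rewrite (_ : (fun x => _) = \sum_i f i); last first.
  by apply/funext => y; rewrite fct_sumE.
apply: (big_ind (fun g : V -> R => Ck k U g)) => //.
  exact: Ck_cst.
by move=> g h Cg Ch; exact: Ck_add.
Qed.

(** A cutoff of class C^2 supported in the Euclidean ball of squared radius [r];
    the third power is the smallest power of the positive part that is C^2. *)
Definition bump (x0 : V) (r : R) (x : V) : R :=
  ppow 3 (r - dotp (x - x0) (x - x0)).

Lemma Ck_gap k x0 (r : R) : Ck k [set: V] (fun x => r - dotp (x - x0) (x - x0)).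
Proof.
have Cc i : Ck k [set: V] (fun x => (x - x0) 0 i).
  apply: Ck_eq (Ck_add openT (Ck_coord k i openT) (Ck_cst k (- x0 0 i) openT)).
    exact: openT.
  by move=> x _; rewrite !mxE.
have Cd := Ck_sum openT (fun i => Ck_mul openT (Cc i) (Cc i)).
apply: Ck_eq (Ck_add openT (Ck_cst k r openT) (Ck_mul openT (Ck_cst k (-1) openT) Cd)).
  exact: openT.
by move=> x _; rewrite mulN1r.
Qed.

Lemma Ck_bump x0 r : Ck 2 setT (bump x0 r).
Proof. exact: (Ck_ppow openT (Ck_gap 2 x0 r)). Qed.

End bump.

Section barrier.
Variables (R : realType) (N Np NA NB : nat) (D : problem R N Np NA NB).
Hypothesis HD : standing_assumptions D.
Local Notation O := (dom D).
Local Notation bO := (boundary (dom D)).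
Local Notation B := (ctrlB D).
Local Notation V := 'rV[R]_N.

Let oO : open O.
Proof. by have [_ [_ [? _ _ _] _ _]] := HD. Qed.

Let bdO : bounded_set O.
Proof. by have [_ [_ [_ _ _ ?] _ _]] := HD. Qed.

(** Nonnegativity is required on the whole boundary, not only on [S], so that two
    such functions can be added. *)
Definition barrier_on (S : set V) := exists phi : V -> R,
  [/\ Ck 2 setT phi,
      forall x b, bO x -> B b -> 0 <= 'D_(gamma D x b) phi x
    & forall x b, bO x -> S x -> B b -> 0 < 'D_(gamma D x b) phi x].

(** The cutoff times a defining function: on the boundary the defining function
    vanishes, so the derivative of the product is the cutoff times the derivative
    of the defining function. *)
Lemma barrier_on_near x0 : bO x0 -> exists2 S, nbhs x0 S & barrier_on S.
Proof.
move=> bx0; have [_ [_ _ /(_ x0 bx0)[W [phi dphi]] _] _ _ _] := HD.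
have [oW Wx0 C3 _ _] := dphi.
have [e /= e0 He] := (nbhs_ballP _ _).1 (open_nbhs_nbhs (conj oW Wx0)).
pose r := (e / 2) ^+ 2.
have r0 : 0 < r by rewrite exprn_gt0// divr_gt0.
pose q x := r - dotp (x - x0) (x - x0).
have qc : continuous q.
  by move=> x; apply: (Ck_continuous openT (Ck_gap 0 x0 r)).
have qW x : 0 <= q x -> W x.
  move=> q0; apply: He; rewrite -ball_normE/= distrC.
  apply: (@le_lt_trans _ _ (e / 2)); last by rewrite ltr_pdivrMr// ltr_pMr// ltr1n.
  apply/mx_norm_leP => [|i j]; first by rewrite divr_ge0// ltW.
  rewrite (ord1 i) -ler_sqr ?nnegrE ?divr_ge0 ?(ltW e0)// -normrX ger0_norm ?sqr_ge0//.
  by apply: (le_trans (entry_sqr_le_dotp _ _)); rewrite -subr_ge0.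
have C2 : Ck 2 W phi by exact: Ck_pred.
have Cprod : Ck 2 W (fun x => bump x0 r x * phi x).
  have CbW : Ck 2 W (bump x0 r) := Ck_sub oW openT (@subsetT _ _) (Ck_bump x0 r).
  exact: (Ck_mul oW CbW C2).
have o2 : open [set x | q x < 0].
  by apply: (@open_comp _ _ q [set u | u < 0]) => [x _|]; [exact: qc|exact: open_lt].
have bump0 x : q x < 0 -> bump x0 r x * phi x = 0.
  by move=> qx; rewrite /bump ppow_neg ?mul0r// ltW.
have C : Ck 2 setT (fun x => bump x0 r x * phi x).
  apply: Ck_local; first exact: openT.
  move=> x _; have [q0|q0] := leP 0 (q x).
    by exists W, (fun x => bump x0 r x * phi x); split=> //; exact: qW.
  exists [set x | q x < 0], (cst 0); split; [exact: o2|exact: q0| |].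
    exact: (Ck_cst 2 0 o2).
  by move=> y /= /bump0.
have Dprod x b : bO x -> B b -> 0 <= q x ->
    'D_(gamma D x b) (fun x => bump x0 r x * phi x) x =
    bump x0 r x * 'D_(gamma D x b) phi x /\ 0 < 'D_(gamma D x b) phi x.
  move=> bx Bb q0; have Wx := qW _ q0.
  have dphi1 : defining_function 1 O x W phi.
    by do 2 apply: defining_function_pred; exact: defining_function_move dphi Wx.
  split; last exact: (oblique_derive_gt0 HD bx Bb dphi1).
  rewrite deriveM; last 2 first.
  - apply: diff_derivable; exact: (Ck_differentiable (Ck_bump x0 r)).
  - apply: diff_derivable; exact: (Ck_differentiable C2).
  by rewrite (defining_function_boundary oO dphi1 bx) scale0r addr0.
exists [set x | 0 < q x].
  apply: open_nbhs_nbhs; split.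
    by apply: (@open_comp _ _ q [set u | 0 < u]) => [x _|]; [exact: qc|exact: open_gt].
  rewrite /= /q subrr /dotp big1 ?subr0// => i _; by rewrite mxE mul0r.
exists (fun x => bump x0 r x * phi x); split; [exact: C|move=> x b bx|move=> x b bx].
  move=> Bb; have [q0|q0] := leP 0 (q x).
    by have [-> D0] := Dprod x b bx Bb q0; rewrite mulr_ge0// ?ppow_ge0// ltW.
  rewrite (near_eq_derive (g := cst 0)) ?derive_cst//.
  by apply: filterS (open_nbhs_nbhs (conj o2 q0)) => y /bump0.
move=> /= q0 Bb; have [-> D0] := Dprod x b bx Bb (ltW q0).
by rewrite mulr_gt0// /bump ppow_pos// exprn_gt0.
Qed.

Lemma barrier_onU S S' : barrier_on S -> barrier_on S' -> barrier_on (S `|` S').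
Proof.
move=> [f [Cf f0 fS]] [g [Cg g0 gS]]; exists (fun x => f x + g x).
have DE x v : 'D_v (fun x => f x + g x) x = 'D_v f x + 'D_v g x.
  by rewrite deriveD//; apply: diff_derivable;
    [exact: (Ck_differentiable Cf)|exact: (Ck_differentiable Cg)].
split=> [|x b bx Bb|x b bx [Sx|Sx] Bb]; first exact: (Ck_add openT Cf Cg).
- by rewrite DE addr_ge0// ?f0// g0.
- by rewrite DE ltr_pwDl// ?fS// g0.
- by rewrite DE ltr_wpDl// ?gS// f0.
Qed.

Lemma barrier_on_boundary : barrier_on bO.
Proof.
(* The sets whose complement carries a barrier form a filter; compactness of
   the boundary, in its near-covering form applied to the relation [y <> x],
   turns local barriers into a global one. *)
pose F : set_system V := [set S | barrier_on (~` S)].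
have FF : Filter F.
  split=> [|S S'|S S' SS'].
  - rewrite /F/= setCT; exists (cst 0).
    split=> [|x b _ _|x b _ []]; first exact: (Ck_cst 2 0 openT).
    by rewrite derive_cst.
  - by rewrite /F/= setCI; exact: barrier_onU.
  - move=> [f [Cf f0 fS]]; exists f.
    split; [exact: Cf|exact: f0|move=> x b bx nS; apply: fS => //].
    by move=> /SS'.
have cbO := compact_boundary oO bdO.
have : \forall y \near F, bO `<=` (fun x => y <> x).
  have /compact_near_coveringP := cbO; apply => x0 bx0.
  have [S nS bS] := barrier_on_near bx0.
  exists (S, ~` S) => /=; first by split=> //; change (barrier_on (~` ~` S)); rewrite setCK.
  by move=> [x y] [/= Sx nSy] yx; apply: nSy; rewrite yx.
rewrite /prop_near1/nbhs/= => -[f [Cf f0 fS]]; exists f.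
split; [exact: Cf|exact: f0|move=> x b bx _].
by apply: fS => //= H; exact: (H x bx).
Qed.

(** Positivity on the compact set of contact points and controls becomes a
    positive lower bound, in a neighborhood of the contact point of a uniform
    size; one constant [c] serves both as the bound and as the size. *)
Lemma barrier : exists (phi : V -> R) (c : R), [/\ Ck 2 setT phi, 0 < c &
  forall x b y, bO x -> B b -> `|y - x| < c -> c < 'D_(gamma D x b) phi y].
Proof.
have [phi [Cphi _ phi0]] := barrier_on_boundary; exists phi.
pose P (c : R) (z : V * 'rV[R]_NB) := bO z.1 -> B z.2 ->
  forall y, `|y - z.1| < c -> c < 'D_(gamma D z.1 z.2) phi y.
have H : \forall c \near (0 : R)^'+, (bO `*` B) `<=` P c.
  have /compact_near_coveringP := compact_contact HD; apply => -[x0 b0] [/= bx0 Bb0].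
  have := phi0 x0 b0 bx0 bx0 Bb0; set d := 'D_(_) _ _ => d0.
  have d2 : d / 2 < d by rewrite ltr_pdivrMr// ltr_pMr// ltr1n.
  have [e e0 He] := derive_gt_near openT (Ck_pred openT Cphi) Logic.I d2.
  have e20 : 0 < e / 2 by rewrite divr_gt0.
  have d20 : 0 < d / 2 by rewrite divr_gt0.
  have n1 : \forall z \near (x0, b0), `|z.1 - x0| < e / 2.
    by apply: filterS (nbhsx_ballx (x0, b0) _ e20) => z []; rewrite -ball_normE/= distrC.
  have n2 := gamma_near HD bx0 Bb0 e0.
  near=> z c; rewrite /P/= => bz Bz y yz.
  have ce : c < e / 2 by near: c; exact: nbhs_right_lt.
  have cd : c < d / 2 by near: c; exact: nbhs_right_lt.
  have zx : `|z.1 - x0| < e / 2 by near: z.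
  have gz : `|gamma D z.1 z.2 - gamma D x0 b0| < e by move: bz Bz; near: z; exact: n2.
  have yx : `|y - x0| < e.
    by rewrite (splitr e) -(subrKA z.1) (le_lt_trans (ler_normD _ _))// ltrD// (lt_trans yz).
  by apply: (lt_trans cd); have [] := He y _ yx gz.
have [c [c0 Hc]] := filter_ex (filterI (nbhs_right_gt (0 : R)) H).
exists c; split; [exact: Cphi|exact: c0|move=> x b y bx Bb; exact: (Hc (x, b))].
Unshelve. all: by end_near. Qed.

End barrier.

(** * Interpolation on a mesh *)

Section meshes.
Variables (R : realType) (N : nat) (O : set 'rV[R]_N) (M : mesh R N).
Hypothesis HM : admissible_mesh O M.
Local Notation V := 'rV[R]_N.

(** At a point of the closed domain the nodal functions take the barycentric
    coordinates of its projection to the polyhedron, so interpolation is an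
    average of nodal values: it is monotone and preserves constants. *)
Lemma nodal_weights x : closure O x -> exists lam : vidx M -> R,
  [/\ forall i, 0 <= lam i, \sum_i lam i = 1
    & forall j, nodal M j (mproj M x) = lam j].
Proof.
have [_ _ [_ _ <- _ _] [Hp _] Hn] := HM => -[y [K KS hy] yx].
have [lam lamK lamx] : hull K (mproj M x) by apply: Hp => //; exists y.
have [lam0 lamN lam1] := lamK.
exists lam; split=> // j; have [_ /(_ K KS lam lamK) nl nv] := Hn j.
rewrite -lamx nl (bigD1 j)//= nv eqxx mulr1 big1 ?addr0// => i ij.
by rewrite nv (negbTE ij) mulr0.
Qed.

Lemma le_interp (f g : vidx M -> R) x : closure O x ->
  (forall i, f i <= g i) -> interp f x <= interp g x.
Proof.
move=> /nodal_weights[lam [lam0 _ lamE]] fg.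
by apply: ler_sum => j _; rewrite lamE ler_wpM2l.
Qed.

Lemma ler_norm_interp (f : vidx M -> R) x : closure O x ->
  `|interp f x| <= interp (fun i => `|f i|) x.
Proof.
move=> /nodal_weights[lam [lam0 _ lamE]].
apply: (le_trans (ler_norm_sum _ _ _)); apply: ler_sum => j _.
by rewrite normrM lamE ger0_norm.
Qed.

Lemma interp_affine (f : vidx M -> R) (a c : R) x : closure O x ->
  interp (fun i => a * f i + c) x = a * interp f x + c.
Proof.
move=> /nodal_weights[lam [_ lam1 lamE]].
rewrite /interp -[X in _ + X]mulr1 -lam1 !mulr_sumr -big_split/=.
by apply: eq_bigr => j _; rewrite lamE mulrDr mulrCA [lam j * c]mulrC.
Qed.

Lemma vtx_hull (K : {set vidx M}) i : i \in K -> hull K (vtx M i).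
Proof.
move=> iK; exists (fun j => (j == i)%:R).
  split=> [j|j jK|]; first exact: ler0n.
    by case: eqP jK => // ->; rewrite iK.
  by rewrite (bigD1 i)//= eqxx big1 ?addr0// => j /negbTE ->.
rewrite (bigD1 i)//= eqxx scale1r big1 ?addr0// => j /negbTE ->.
by rewrite scale0r.
Qed.

Lemma hull_bounded (K : {set vidx M}) x : hull K x -> `|x| <= \sum_i `|vtx M i|.
Proof.
move=> [lam [lam0 _ lam1] <-]; apply: (le_trans (ler_norm_sum _ _ _)).
apply: ler_sum => i _; rewrite normrZ ger0_norm// ler_piMl//.
by rewrite -lam1 (bigD1 i)//= lerDl sumr_ge0.
Qed.


(** For [h = 0] the boundary equations would degenerate to [U i = U i]; a simplex
    with at least two distinct vertices excludes it. *)
Lemma meshsize_gt0 : (0 < N)%N -> O !=set0 -> 0 < meshsize M.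
Proof.
move=> N0 [x Ox]; have [_ [vinj _ cardK _ _] [_ _ chO _ _] _ _] := HM.
have [y [K KS _] _] : (chart M @` polyhedron M) x by rewrite chO; exact: subset_closure.
have : (1 < #|K|)%N by rewrite cardK// ltnS.
move/card_gt1P => [i [j [iK jK ij]]].
have d0 : 0 < enorm (vtx M i - vtx M j).
  rewrite sqrtr_gt0; apply: dotp_gt0; rewrite subr_eq0.
  by apply: contra ij => /eqP/vinj ->.
apply: (lt_le_trans d0); apply: (@le_trans _ _ (ediam (hull K))); last first.
  by rewrite /meshsize (bigD1 K)//= le_max lexx.
apply: ub_le_sup; last first.
  by exists (vtx M i, vtx M j) => //; split; exact: vtx_hull.
exists (N%:R * (\sum_i `|vtx M i| + \sum_i `|vtx M i|)) => _ [[u w] [/= hu hw] <-].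
apply: (le_trans (enorm_le_norm _)); rewrite ler_wpM2l//.
by rewrite (le_trans (ler_normB _ _))// lerD//; exact: (@hull_bounded K).
Qed.

End meshes.

(** * Moments of the random branches *)

Lemma norm_inf_le {R : realType} (S : set R) (Z : R) : S !=set0 ->
  (forall y, S y -> `|y| <= Z) -> `|inf S| <= Z.
Proof.
move=> [y Sy] H; rewrite ler_norml; apply/andP; split.
  by apply: lb_le_inf => [|w /H]; [exists y|rewrite ler_norml => /andP[]].
apply: (@le_trans _ _ y); last by have := H _ Sy; rewrite ler_norml => /andP[].
by apply: ge_inf => //; exists (- Z) => w /H; rewrite ler_norml => /andP[].
Qed.

Section random_signs.
Variables (R : realType) (m : nat).
Local Notation signs := {ffun 'I_m -> bool}.

Lemma card_signs : #|{: signs}| = (2 ^ m)%N.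
Proof. by rewrite card_ffun card_bool card_ord. Qed.

Definition flip (s : signs) : signs := [ffun j => ~~ s j].

Lemma flipK : involutive flip.
Proof. by move=> s; apply/ffunP => j; rewrite !ffunE negbK. Qed.

Lemma xi_flip s : xi (flip s) = - xi s :> 'rV[R]_m.
Proof. by apply/rowP => j; rewrite !mxE ffunE signrN. Qed.

(** The signs cancel in pairs under [flip]. *)
Lemma sum_odd_signs (f : 'rV[R]_m -> R) : (forall v, f (- v) = - f v) ->
  \sum_(s : signs) f (xi s) = 0.
Proof.
move=> fN; set S := \sum_s _.
have SN : S = - S.
  rewrite {1}/S (reindex_inj (inv_inj flipK)) -sumrN.
  by apply: eq_bigr => s _; rewrite xi_flip fN.
by lra.
Qed.

Lemma norm_xi_le1 (s : signs) : `|xi s : 'rV[R]_m| <= 1.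
Proof. by apply/mx_norm_leP => // i j; rewrite mxE normrX normrN1 expr1n. Qed.

Lemma norm_xi_mul n (s : signs) (A : 'M[R]_(n, m)) :
  `|xi s *m A^T| <= m%:R * `|A|.
Proof.
apply/mx_norm_leP => [|i j]; first by rewrite mulr_ge0.
rewrite mxE; apply: (le_trans (ler_norm_sum _ _ _)).
apply: (@le_trans _ _ (\sum_(k < m) `|A|)); last first.
  by rewrite sumr_const card_ord mulr_natl.
apply: ler_sum => k _; rewrite normrM -[leRHS]mul1r ler_pM//.
  exact: le_trans (mx_entry_le _ _ _) (norm_xi_le1 s).
by rewrite mxE; exact: mx_entry_le.
Qed.

End random_signs.

Section scheme_bounds.
Variables (R : realType) (N Np NA NB : nat) (D : problem R N Np NA NB).
Hypothesis HD : standing_assumptions D.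
Local Notation O := (dom D).
Local Notation bO := (boundary (dom D)).
Local Notation A := (ctrlA D).
Local Notation B := (ctrlB D).
Local Notation V := 'rV[R]_N.

Let oO : open O.
Proof. by have [_ [_ [? _ _ _] _ _]] := HD. Qed.

Let bdO : bounded_set O.
Proof. by have [_ [_ [_ _ _ ?] _ _]] := HD. Qed.

Let T0 : 0 < horizon D.
Proof. by have [_ [? _ _ _]] := HD. Qed.

Lemma dt_gt0 NT : (0 < NT)%N -> 0 < dt D NT.
Proof. by move=> NT0; rewrite divr_gt0// ltr0n. Qed.

Lemma tgrid_horizon NT : (0 < NT)%N -> tgrid D NT NT = horizon D.
Proof. by move=> NT0; rewrite /tgrid /dt mulrC divfK// pnatr_eq0 -lt0n. Qed.

Lemma tgrid_in NT n : (0 < NT)%N -> (n <= NT)%N -> 0 <= tgrid D NT n <= horizon D.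
Proof.
move=> NT0 nNT; rewrite mulr_ge0 ?(ltW (dt_gt0 NT0))//=.
by rewrite -(tgrid_horizon NT0) /tgrid ler_wpM2r ?ler_nat// ltW// dt_gt0.
Qed.

Lemma coefficient_bounds : exists C : R, 0 <= C /\
  [/\ forall t x a, 0 <= t <= horizon D -> closure O x -> A a ->
        [/\ `|sigma D t x a| <= C, `|mu D t x a| <= C & `|fcost D t x a| <= C],
      forall t x b, 0 <= t <= horizon D -> bO x -> B b -> `|gcost D t x b| <= C
    & forall x, closure O x -> `|Psi D x| <= C].
Proof.
have [_ _ [[_ cA _ cB] [sc mc fc _] [gc _ Pc] _ _] _ _] := HD.
have cI : compact `[0, horizon D] by exact: segment_compact.
have cO := compact_closure bdO; have cbO := compact_boundary oO bdO.
have cIOA := compact_setX (compact_setX cI cO) cA.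
have cIOB := compact_setX (compact_setX cI cbO) cB.
have [Cs Cs0 Hs] := compact_bound cIOA sc.
have [Cm Cm0 Hm] := compact_bound cIOA mc.
have [Cf Cf0 Hf] := compact_bound cIOA fc.
have [Cg Cg0 Hg] := compact_bound cIOB gc.
have [Cp Cp0 Hp] := compact_bound cO Pc.
exists (Cs + Cm + Cf + Cg + Cp); split; first by rewrite !addr_ge0.
split=> [t x a t01 cx Aa|t x b t01 bx Bb|x cx].
- have H : (`[0, horizon D] `*` closure O `*` A) (t, x, a).
    by split=> //; split=> //; rewrite /= in_itv.
  split.
  + by apply: (le_trans (Hs _ H)); lra.
  + by apply: (le_trans (Hm _ H)); lra.
  + by apply: (le_trans (Hf _ H)); lra.
- have H : (`[0, horizon D] `*` bO `*` B) (t, x, b).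
    by split=> //; split=> //; rewrite /= in_itv.
  by apply: (le_trans (Hg _ H)); lra.
- by apply: (le_trans (Hp _ cx)); lra.
Qed.

Lemma Xstar_sub NT n x a s : Xstar D NT n x a s - x =
  dt D NT *: mu D (tgrid D NT n) x a
    + Num.sqrt (dt D NT) *: (xi s *m (sigma D (tgrid D NT n) x a)^T).
Proof. by rewrite /Xstar -(addrA x) addrAC subrr add0r. Qed.

Lemma Xstar_displacement NT n x a s (C : R) : 0 < dt D NT <= 1 ->
  `|sigma D (tgrid D NT n) x a| <= C -> `|mu D (tgrid D NT n) x a| <= C ->
  `|Xstar D NT n x a s - x| <= Num.sqrt (dt D NT) * ((Np%:R + 1) * C).
Proof.
set d := dt D NT => /andP[d0 d1] Hs Hm.
rewrite Xstar_sub -/d.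
apply: (le_trans (ler_normD _ _)).
rewrite mulrDl mul1r mulrDr addrC lerD//.
  rewrite normrZ ger0_norm ?sqrtr_ge0// ler_wpM2l ?sqrtr_ge0//.
  by apply: (le_trans (norm_xi_mul _ _)); rewrite ler_wpM2l.
rewrite normrZ (ger0_norm (ltW d0)) ler_pM// ?(ltW d0)//.
rewrite -{1}(sqr_sqrtr (ltW d0)) expr2 ler_piMr ?sqrtr_ge0//.
by rewrite -sqrtr1 ler_wsqrtr.
Qed.

(** In the expansion of [phi] at [x] the diffusion term of order [sqrt dt] is odd
    in the signs and averages to zero; the drift term and the quadratic remainder
    are of order [dt].  The bound on [dt] keeps the branches within distance 1 of
    the domain, where the second derivatives of [phi] are controlled. *)
Lemma average_Xstar (phi : V -> R) : Ck 2 setT phi -> exists2 C, 0 <= C &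
  exists2 r : R, 0 < r & forall NT n x a,
  (0 < NT)%N -> (n <= NT)%N -> dt D NT <= r -> closure O x -> A a ->
  \sum_s phi (Xstar D NT n x a s) <= 2 ^+ Np * (phi x + C * dt D NT).
Proof.
move=> Cphi; have [dphi Dphi] := Cphi.
have [Cc [Cc0 [HC _ _]]] := coefficient_bounds.
have idc : {within closure O, continuous (id : V -> V)}.
  by apply: continuous_subspaceT => x; exact: cvg_id.
have [rad rad0 Hrad] := compact_bound (compact_closure bdO) idc.
pose Q : set V := [set y | `|y| <= rad + 1].
have cQ : compact Q.
  apply: bounded_closed_compact.
    exists (rad + 1); split; first by rewrite realD// ger0_real.
    by move=> m Hm y /= /le_trans; apply; exact: ltW.
  apply: (@closed_comp _ _ (fun y : V => `|y|) [set u | u <= rad + 1]).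
    by move=> y _; exact: norm_continuous.
  exact: closed_le.
have [CT CT0 HT] := taylor_bound Cphi cQ.
have gc : continuous (fun x => \sum_i `|partial i phi x|).
  move=> x; apply: sum_continuous => i.
  have pc := Ck_continuous (k := 1) openT (Dphi (delta_mx 0 i)) (Logic.I : [set: V] x).
  exact: (cvg_norm pc).
have [CG CG0 HG] := compact_bound (compact_closure bdO) (continuous_subspaceT gc).
pose L := (Np%:R + 1) * Cc.
have L0 : 0 <= L by rewrite mulr_ge0// addr_ge0.
exists (Cc * CG + CT * L ^+ 2); first by rewrite addr_ge0// mulr_ge0// sqr_ge0.
exists (Num.min 1 ((1 + L) ^- 2)).
  by rewrite lt_min ltr01 invr_gt0 exprn_gt0// ltr_wpDr.
move=> NT n x a NT0 nNT; rewrite le_min => /andP[d1 dL] cx Aa.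
have d0 := dt_gt0 NT0.
have [Hs Hm _] := HC _ x a (tgrid_in NT0 nNT) cx Aa.
set d := dt D NT in d0 d1 dL *.
have sd : Num.sqrt d * L <= 1.
  have : Num.sqrt d <= (1 + L)^-1.
    by rewrite -[leRHS]ger0_norm ?invr_ge0 ?addr_ge0// -sqrtr_sqr ler_wsqrtr// exprVn.
  move=> H; apply: (@le_trans _ _ ((1 + L)^-1 * L)); first by rewrite ler_wpM2r.
  by rewrite ler_pdivrMl ?ltr_wpDr// mulr1 lerDr.
pose v s := Xstar D NT n x a s - x.
have vle s : `|v s| <= Num.sqrt d * L.
  by apply: Xstar_displacement => //; rewrite d0.
have E s : phi (Xstar D NT n x a s) <= phi x + 'D_(v s) phi x + CT * L ^+ 2 * d.
  have -> : Xstar D NT n x a s = x + v s by rewrite /v addrC subrK.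
  have : `|phi (x + v s) - phi x - 'D_(v s) phi x| <= CT * `|v s| ^+ 2.
    apply: HT => t /andP[t0 t1]; rewrite /Q/= (le_trans (ler_normD _ _))// lerD//.
      exact: Hrad.
    rewrite normrZ ger0_norm// (le_trans _ sd)// (le_trans _ (vle s))//.
    by rewrite ler_piMl.
  have : CT * `|v s| ^+ 2 <= CT * L ^+ 2 * d.
    rewrite -mulrA ler_wpM2l// -[X in _ * X](sqr_sqrtr (ltW d0)) -exprMn.
    by rewrite lerXn2r ?nnegrE ?mulr_ge0 ?sqrtr_ge0// mulrC.
  by rewrite ler_norml => + /andP[_]; lra.
apply: (le_trans (ler_sum _ (fun s _ => E s))).
rewrite !big_split/= !sumr_const card_signs.
have -> : \sum_s 'D_(v s) phi x = (d * 'D_(mu D (tgrid D NT n) x a) phi x) *+ (2 ^ Np).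
  pose f (e : 'rV[R]_Np) := Num.sqrt d *
    'D_(e *m (sigma D (tgrid D NT n) x a)^T) phi x.
  have fN e : f (- e) = - f e.
    by rewrite /f mulNmx -scaleN1r derive_scale ?mulN1r ?mulrN//; exact: dphi.
  have dx : differentiable phi x by exact: dphi.
  rewrite (eq_bigr (fun s => d * 'D_(mu D (tgrid D NT n) x a) phi x + f (xi s))).
    by rewrite big_split/= sum_odd_signs// addr0 sumr_const card_signs.
  move=> s _; by rewrite /v Xstar_sub deriveE// linearD !linearZ /f !deriveE.
rewrite -!mulrnDl -[leLHS]mulr_natl natrX ler_wpM2l// -addrA lerD2l.
rewrite mulrDl lerD2r mulrC ler_wpM2r ?(ltW d0)//.
apply: (le_trans (ler_norm _)); apply: (le_trans (derive_le _ (dphi x Logic.I))).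
rewrite ler_pM//; first by rewrite sumr_ge0.
exact: (le_trans (ler_norm _) (HG x cx)).
Qed.

End scheme_bounds.

(** * Barrier estimates for one step of the scheme *)

(** All that the estimates of the scheme use about a branch that leaves the
    domain. *)
Definition reflection_gain {R : realType} {N Np NA NB : nat}
    (D : problem R N Np NA NB) (phi : 'rV[R]_N -> R) (c : R) (X : 'rV[R]_N)
    (b : 'rV[R]_NB) : Prop :=
  let p := projg D X b in
  let d := 2 * distg D X b in
  ~ closure (dom D) X ->
  [/\ boundary (dom D) p, 0 < d, closure (dom D) (X - d *: gamma D p b)
    & d * c <= phi X - phi (X - d *: gamma D p b)].

Section stability.
Variables (R : realType) (N Np NA NB : nat) (D : problem R N Np NA NB).
Hypothesis HD : standing_assumptions D.
Local Notation O := (dom D).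
Local Notation bO := (boundary (dom D)).
Local Notation B := (ctrlB D).
Local Notation V := 'rV[R]_N.
Variables (phi : V -> R) (c : R).
Hypothesis Cphi : Ck 2 setT phi.
Hypothesis c0 : 0 < c.
Hypothesis phi_oblique : forall x b y, bO x -> B b -> `|y - x| < c ->
  c < 'D_(gamma D x b) phi y.

Let oO : open O.
Proof. by have [_ [_ [? _ _ _] _ _]] := HD. Qed.

(** Both points lie on the oblique line through the contact point [x], within
    distance [c] of it, where the derivative of [phi] along the line exceeds [c]. *)
Lemma barrier_increment x b u v : bO x -> B b -> u <= v ->
  - c < u -> v < c ->
  (v - u) * c <= phi (x + v *: gamma D x b) - phi (x + u *: gamma D x b).
Proof.
move=> bx Bb uv cu vc; set g := gamma D x b.
have dphi y : differentiable phi y by have [d _] := Cphi; exact: d.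
have [t /andP[t0 t1]] := @MVT_line _ _ phi (x + u *: g) ((v - u) *: g)
  (fun t _ => dphi _).
rewrite -addrA -scalerDl (addrC u) subrK => ->.
rewrite derive_scale// ler_wpM2l ?subr_ge0//; apply/ltW/phi_oblique => //.
rewrite scalerA -(addrA x) -scalerDl addrAC subrr add0r normrZ.
rewrite (le_lt_trans (ler_piMr _ (norm_gamma_le1 HD bx Bb)))//.
have : t * (v - u) <= v - u by rewrite ler_piMl// subr_ge0.
have : 0 <= t * (v - u) by rewrite mulr_ge0// subr_ge0.
by rewrite ltr_norml; lra.
Qed.

(** A branch [X] that leaves the closed domain from a nearby point [x] crosses the
    boundary, hence lies in the tube with a small oblique distance, which is
    positive since backward steps along the oblique field stay in the domain. *)
Lemma reflection_increment : exists2 eta : R, 0 < eta & forall x b X,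
  O x -> B b -> `|X - x| < eta -> reflection_gain D phi c X b.
Proof.
have [s0 s00 Hs0] := inward_uniform HD.
have sc0 : 0 < Num.min s0 c by rewrite lt_min s00.
have [eta eta0 Heta] := distg_small HD sc0.
exists eta => // x b X Ox Bb Xx p d ncX.
have [t /andP[t0 t1] by_] := segment_meets_boundary oO Ox ncX.
set y := x + t *: (X - x) in by_.
have Xy : `|X - y| < eta.
  have -> : X - y = (1 - t) *: (X - x).
    by rewrite /y scalerBl scale1r opprD addrA.
  rewrite normrZ ger0_norm ?subr_ge0// (le_lt_trans _ Xx)// ler_piMl//.
  by rewrite lerBlDr lerDl.
have [tX] := Heta _ _ _ by_ Bb Xy; rewrite lt_min => /andP[ds0 dc].
have [_ _ _ _ [_ _ /(_ X b tX Bb)[bp _ XE _] _ _]] := HD.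
rewrite -/p in bp XE.
have d0 : 0 < distg D X b.
  rewrite ltNge; apply/negP; rewrite le_eqVlt => /orP[/eqP dE|dn].
    by apply: ncX; rewrite XE dE scale0r addr0; exact: (proj1 bp).
  apply: ncX; apply: subset_closure; rewrite XE.
  rewrite -[distg D X b]opprK scaleNr; apply: Hs0 => //.
  by rewrite oppr_gt0 dn -(ltr0_norm dn) ltW.
rewrite (gtr0_norm d0) in ds0 dc.
have XrE : X - d *: gamma D p b = p + (- distg D X b) *: gamma D p b.
  by rewrite {1}XE -addrA -scalerBl; congr (_ + _ *: _); rewrite /d; ring.
rewrite XrE; split=> //; first by rewrite mulr_gt0.
  by apply: subset_closure; rewrite scaleNr; apply: Hs0; rewrite ?d0 ?ltW.
have H1 : - distg D X b <= distg D X b by lra.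
have H2 : - c < - distg D X b by rewrite ltrN2.
have := barrier_increment bp Bb H1 H2 dc.
by rewrite -XE opprK /d; lra.
Qed.

End stability.

Section one_mesh.
Variables (R : realType) (N Np NA NB : nat) (D : problem R N Np NA NB).
Hypothesis HD : standing_assumptions D.
Local Notation O := (dom D).
Local Notation bO := (boundary (dom D)).
Local Notation A := (ctrlA D).
Local Notation B := (ctrlB D).
Local Notation V := 'rV[R]_N.
Variables (phi : V -> R) (c : R) (M : mesh R N) (E K G : R).
Hypothesis HM : admissible_mesh O M.
Hypothesis K0 : 0 <= K.
Hypothesis herr : forall x, closure O x ->
  interp (fun i => phi (vtx M i)) x <= phi x + E.

Let oO : open O.
Proof. by have [_ [_ [? _ _ _] _ _]] := HD. Qed.

Lemma interp_barrier (U : vidx M -> R) C x : closure O x ->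
  (forall i, `|U i| <= K * phi (vtx M i) + C) ->
  `|interp U x| <= K * (phi x + E) + C.
Proof.
move=> cx HU; apply: (le_trans (ler_norm_interp HM U cx)).
apply: (le_trans (le_interp HM cx HU)).
by rewrite (interp_affine HM)// lerD2r ler_wpM2l// herr.
Qed.

Hypothesis gK : G <= K * c.

(** The gain of [K * phi] under reflection, at least [d * (K * c)], covers the
    reflection cost, at most [d * G]. *)
Lemma branch_barrier NT n (U : vidx M -> R) C x a b s :
  0 <= tgrid D NT n <= horizon D -> B b ->
  (forall y, bO y -> `|gcost D (tgrid D NT n) y b| <= G) ->
  reflection_gain D phi c (Xstar D NT n x a s) b ->
  (forall i, `|U i| <= K * phi (vtx M i) + C) ->
  `|branch D NT n U x a b s| <= K * (phi (Xstar D NT n x a s) + E) + C.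
Proof.
rewrite /reflection_gain; set X := Xstar _ _ _ _ _ _; set p := projg _ _ _.
set d := 2 * _; move=> t01 Bb HG Hrefl HU.
rewrite /branch -/X -/p -/d; case: ifPn => [|].
  rewrite inE => cX; rewrite !mul0r oppr0 expR0 mul1r addr0.
  exact: interp_barrier.
rewrite notin_setE => /Hrefl[bp d0 cXr incr].
set k := krate _ _ _ _; set g := gcost _ _ _ _; set Xr := X - _ in cXr incr *.
have k0 : 0 <= k by have [_ _ [_ _ _ _ [_ H]] _ _] := HD; exact: H.
have eN (r : R) : 0 <= r -> 0 <= expR (- r) <= 1.
  by move=> r0; rewrite expR_ge0/= -expR0 ler_expR oppr_le0.
have /andP[e10 e11] := eN (k * d) (mulr_ge0 k0 (ltW d0)).
have /andP[e20 e21] : 0 <= expR (- (k * d) / 2) <= 1.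
  by rewrite mulNr; apply: eN; rewrite divr_ge0// mulr_ge0// ltW.
apply: (le_trans (ler_normD _ _)); clearbody d.
rewrite !normrM (ger0_norm e10) (ger0_norm e20) (ger0_norm (ltW d0)).
have G1 : d * expR (- (k * d) / 2) * `|g| <= d * G.
  rewrite -mulrA ler_wpM2l ?(ltW d0)// -[leRHS]mul1r ler_pM//.
  exact: HG.
have I1 : expR (- (k * d)) * `|interp U Xr| <= K * (phi Xr + E) + C.
  by apply: le_trans (interp_barrier cXr HU); rewrite ler_piMl.
have G2 : d * G <= d * (K * c) by rewrite ler_wpM2l// ltW.
have : K * (d * c) <= K * (phi X - phi Xr) by rewrite ler_wpM2l.
by lra.
Qed.

(** The constant [C] is the value of the space-independent part of the barrier at
    the later time; the last two terms are what it has to gain in one step. *)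
Lemma interior_barrier NT n (U : vidx M -> R) C CX Fb i :
  (0 < NT)%N -> (n < NT)%N ->
  O (vtx M i) ->
  (forall t x b, 0 <= t <= horizon D -> bO x -> B b -> `|gcost D t x b| <= G) ->
  (forall t x a, 0 <= t <= horizon D -> closure O x -> A a ->
     `|fcost D t x a| <= Fb) ->
  (forall a b s, A a -> B b ->
     reflection_gain D phi c (Xstar D NT n (vtx M i) a s) b) ->
  (forall a, A a -> \sum_s phi (Xstar D NT n (vtx M i) a s) <=
     2 ^+ Np * (phi (vtx M i) + CX * dt D NT)) ->
  (forall j, `|U j| <= K * phi (vtx M j) + C) ->
  `|scheme_int D NT n U i| <=
    K * phi (vtx M i) + C + K * E + (K * CX + Fb) * dt D NT.
Proof.
move=> NT0 nNT Oi HG HF Hrefl Havg HU.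
have [_ _ [[[a0 Aa0] _ [b0 Bb0] _] _ _ _ [Hr _]] _ _] := HD.
have tin := tgrid_in HD NT0 (ltnW nNT).
apply: norm_inf_le.
  by exists (scheme_ab D NT n U i a0 b0); exists (a0, b0).
move=> _ [[a b] [/= Aa Bb] <-]; rewrite /scheme_ab.
set x := vtx M i in Oi Hrefl Havg *.
have cx : closure O x by exact: subset_closure.
have d0 := dt_gt0 HD NT0; set d := dt D NT in d0 Havg *; clearbody d.
apply: (le_trans (ler_normD _ _)); rewrite !normrM (ger0_norm (ltW d0)).
have F1 : d * `|fcost D (tgrid D NT n) x a| <= d * Fb.
  by rewrite ler_wpM2l ?(ltW d0)// HF.
have P0 : 0 < (2 ^+ Np : R) by rewrite exprn_gt0.
have r1 : `|(1 + rrate D (tgrid D NT n) x a * d)^-1| <= 1.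
  have r0 : 0 <= rrate D (tgrid D NT n) x a * d.
    by rewrite mulr_ge0 ?(ltW d0)// Hr//= in_itv.
  by rewrite ger0_norm ?invr_ge0 ?addr_ge0// invf_le1 ?ltr_wpDr// lerDl.
have S1 : `|(2 ^+ Np)^-1| * `|\sum_s branch D NT n U x a b s| <=
    K * (phi x + CX * d + E) + C.
  rewrite ger0_norm ?invr_ge0 ?(ltW P0)// ler_pdivrMl//.
  apply: (le_trans (ler_norm_sum _ _ _)).
  apply: (@le_trans _ _ (\sum_s (K * (phi (Xstar D NT n x a s) + E) + C))).
    apply: ler_sum => s _; apply: branch_barrier => //.
      by move=> y by_; exact: HG.
    exact: Hrefl.
  rewrite big_split/= -mulr_sumr big_split/= !sumr_const card_signs.
  rewrite -(mulr_natl E) -(mulr_natl C) natrX.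
  have := Havg a Aa; move: (\sum_s _) => S HS.
  have : K * S <= K * (2 ^+ Np * (phi x + CX * d)) by rewrite ler_wpM2l.
  by lra.
have : `|(1 + rrate D (tgrid D NT n) x a * d)^-1| *
    (`|(2 ^+ Np)^-1| * `|\sum_s branch D NT n U x a b s|) <=
    `|(2 ^+ Np)^-1| * `|\sum_s branch D NT n U x a b s|.
  by rewrite ler_piMl// mulr_ge0.
by lra.
Qed.

(** Maximum principle for the coupled boundary equations.  At a node [i] where the
    excess [w] of [|U|] over the barrier is largest, and positive, all nodal values
    are bounded by the barrier plus [w i]; inserting this in the equation at [i]
    bounds [|U i|] by the barrier plus [w i] minus the gap, a contradiction. *)
Lemma boundary_barrier NT n (U : vidx M -> R) C ell : (0 < NT)%N -> (n < NT)%N ->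
  (forall t x b, 0 <= t <= horizon D -> bO x -> B b -> `|gcost D t x b| <= G) ->
  0 <= ell ->
  (forall x b, bO x -> B b -> closure O (x - ell *: gamma D x b) /\
     ell * c <= phi x - phi (x - ell *: gamma D x b)) ->
  K * E + ell * G < K * (ell * c) ->
  (forall i, O (vtx M i) -> `|U i| <= K * phi (vtx M i) + C) ->
  (forall i, bO (vtx M i) -> U i = scheme_bd D ell NT n U i) ->
  forall i, `|U i| <= K * phi (vtx M i) + C.
Proof.
move=> NT0 nNT HG ell0 Hin Hgap HO HbO i0; rewrite leNgt; apply/negP => Hi0.
have tin := tgrid_in HD NT0 (ltnW nNT).
pose w i := `|U i| - (K * phi (vtx M i) + C).
pose i := [arg max_(i > i0) w i]%O.
have wi j : w j <= w i by rewrite /i; case: arg_maxP => // k _; apply.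
have wpos : 0 < w i by rewrite (lt_le_trans _ (wi i0))// subr_gt0.
have bi : bO (vtx M i).
  have [cv _ _ _ _] := HM.
  have [Oi|//] := closure_dom_or_boundary oO (cv i).
  by move: wpos; rewrite subr_gt0 ltNge HO.
have HU j : `|U j| <= K * phi (vtx M j) + (C + w i).
  by rewrite addrA -lerBlDl; exact: wi.
have : `|U i| <= K * (phi (vtx M i) - ell * c + E) + (C + w i) + ell * G.
  have [_ _ [[_ _ [b0 Bb0] _] _ _ _ [_ Hk]] _ _] := HD.
  rewrite HbO//; apply: norm_inf_le; first by eexists; exists b0.
  move=> _ [b Bb <-]; have [cy incr] := Hin _ b bi Bb.
  set y := _ - _ in cy incr *; set k := krate _ _ _ _; set g := gcost _ _ _ _.
  have k0 : 0 <= ell * k by rewrite mulr_ge0// Hk//= in_itv.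
  rewrite normrM [X in _ * X]ger0_norm ?invr_ge0 ?addr_ge0//.
  rewrite ler_pdivrMr ?ltr_wpDr//.
  set Z := leRHS.
  have Z0 : `|interp U y + ell * g| <=
      K * (phi (vtx M i) - ell * c + E) + (C + w i) + ell * G.
    apply: (le_trans (ler_normD _ _)); rewrite lerD//.
      apply: (le_trans (interp_barrier cy HU)); rewrite lerD2r ler_wpM2l// lerD2r.
      by lra.
    by rewrite normrM ger0_norm// ler_wpM2l// HG.
  apply: (le_trans Z0); rewrite /Z ler_peMr ?lerDl//.
  exact: le_trans Z0.
rewrite leNgt => /negP; apply.
rewrite (_ : `|U i| = K * phi (vtx M i) + C + w i); last by rewrite /w addrC subrK.
by lra.
Qed.

End one_mesh.

(** * Stability *)

(** Backward induction in time; within a time level the interior nodes precede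
    the boundary nodes. *)
Lemma stability_estimate (R : realType) (N Np NA NB : nat)
    (D : problem R N Np NA NB) (c0 c1 Cm : R) :
  standing_assumptions D -> 0 < c0 ->
  exists C theta : R, 0 < theta /\
    forall (M : mesh R N) (ell : R) (NT : nat) (U : nat -> vidx M -> R),
    admissible_mesh (dom D) M ->
    (forall phi, C2_closure (dom D) phi -> forall x, closure (dom D) x ->
       `|interp (fun i => phi (vtx M i)) x - phi x| <=
         Cm * C2norm (dom D) phi * meshsize M ^+ 2) ->
    c0 * meshsize M <= ell <= c1 * meshsize M ->
    (0 < NT)%N -> dt D NT <= theta -> meshsize M <= theta ->
    meshsize M ^+ 2 <= dt D NT ->
    discrete_solution D ell NT U ->
    forall n, (n <= NT)%N -> forall i, `|U n i| <= C.
Proof.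
move=> HD c00.
have [Np1 [T0 [oO _ O0 bdO] _ _] _ _ _] := HD.
have N0 : (0 < N)%N by case/andP: Np1 => /leq_trans H /H.
have [phi [c [Cphi cpos Hphi]]] := barrier HD.
have [G [G0 [HC HG HPsi]]] := coefficient_bounds HD.
have [s0 s00 Hs0] := inward_uniform HD.
have [eta eta0 Heta] := reflection_increment HD Cphi cpos Hphi.
have [CX CX0 [r r0 HX]] := average_Xstar HD Cphi.
have phic : {within closure (dom D), continuous phi}.
  by apply: continuous_subspaceT => x; exact: (Ck_continuous openT Cphi).
have [CP CP0 HP] := compact_bound (compact_closure bdO) phic.
(* The reflection costs only need [K * c >= G]; the extra 1 provides the gap
   [ell] in the boundary equations. *)
pose K := (G + 1) / c.
have Kc : K * c = G + 1 by rewrite divfK// gt_eqF.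
have K0 : 0 < K by rewrite divr_gt0// ltr_wpDl.
pose E0 := `|Cm * C2norm (dom D) phi|.
have E00 : 0 <= E0 by exact: normr_ge0.
(* [C0] dominates the terminal data, [C2] the growth per unit of time. *)
pose C0 := G + K * CP.
pose C2 := K * E0 + K * CX + G.
have KE0 : 0 <= K * E0 by rewrite mulr_ge0// ltW.
have KCX0 : 0 <= K * CX by rewrite mulr_ge0// ltW.
have C20 : 0 <= C2 by rewrite !addr_ge0.
pose L := (Np%:R + 1) * G + 1.
have L0 : 0 < L by rewrite ltr_wpDl// mulr_ge0// addr_ge0.
pose c1' := `|c1| + 1.
have c1'0 : 0 < c1' by rewrite ltr_wpDl.
pose m := Num.min s0 c.
have m0 : 0 < m by rewrite lt_min s00.
exists (K * CP + C0 + C2 * horizon D).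
(* In this order: the branches stay close to the domain, the branches stay in
   the tube, the boundary steps stay in the domain, and the interpolation error
   at the boundary stays below [ell]. *)
exists (Num.min (Num.min (Num.min 1 r) ((eta / L / 2) ^+ 2))
   (Num.min (m / c1' / 2) (c0 / (K * E0 + 1) / 2))).
split.
  have sq0 : 0 < (eta / L / 2) ^+ 2 by rewrite exprn_gt0// !divr_gt0.
  by rewrite !lt_min ltr01 r0 sq0 !divr_gt0// ltr_wpDl.
move=> M ell NT U HM Herr /andP[ell1 ell2] NT0.
rewrite !le_min => /andP[/andP[/andP[dt1 dtr] dteta] _].
move=> /andP[_ /andP[hm hE]] hdt [UT Ustep].
have h0 := meshsize_gt0 HM N0 O0.
have d0 := dt_gt0 HD NT0.
have ell0 : 0 < ell by rewrite (lt_le_trans _ ell1)// mulr_gt0.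
have ellm : ell < m.
  apply: (le_lt_trans ell2); apply: (@le_lt_trans _ _ (c1' * (m / c1' / 2))).
    apply: (@le_trans _ _ (c1' * meshsize M)).
      by rewrite ler_wpM2r ?(ltW h0)// /c1' (le_trans (ler_norm _))// lerDl.
    by rewrite ler_wpM2l// ltW.
  by rewrite mulrA mulrCA divff ?gt_eqF// mulr1 ltr_pdivrMr// ltr_pMr// ltr1n.
have [ells0 ellc] : ell < s0 /\ ell < c by apply/andP; rewrite -lt_min.
have sqd : Num.sqrt (dt D NT) * ((Np%:R + 1) * G) < eta.
  have H1 : Num.sqrt (dt D NT) <= eta / L / 2.
    have p0 : 0 <= eta / L / 2 by rewrite !divr_ge0// ltW.
    by rewrite -(ger0_norm p0) -sqrtr_sqr ler_wsqrtr.
  apply: (@le_lt_trans _ _ (eta / L / 2 * L)).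
    by rewrite ler_pM ?sqrtr_ge0 ?mulr_ge0 ?addr_ge0// lerDl.
  by rewrite mulrAC divfK ?gt_eqF// ltr_pdivrMr// ltr_pMr// ltr1n.
set h := meshsize M in h0 hm hE hdt ell1 ell2 Herr.
pose E := E0 * h ^+ 2.
have herr x : closure (dom D) x -> interp (fun i => phi (vtx M i)) x <= phi x + E.
  move=> cx; have := Herr phi (C2_closure_of_Ck _ Cphi) x cx.
  rewrite ler_norml => /andP[_]; rewrite lerBlDl => /le_trans; apply.
  by rewrite lerD2l ler_wpM2r ?sqr_ge0// ler_norm.
have gK : G <= K * c by rewrite Kc lerDl.
have gap : K * E + ell * G < K * (ell * c).
  rewrite [ltRHS]mulrCA Kc mulrDr mulr1 addrC ltrD2l (lt_le_trans _ ell1)//.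
  rewrite /E mulrA expr2 mulrA ltr_pM2r//.
  apply: (@le_lt_trans _ _ ((K * E0 + 1) * (c0 / (K * E0 + 1) / 2))).
    by rewrite ler_pM ?(ltW h0)// lerDl.
  have Q0 : 0 < K * E0 + 1 by rewrite ltr_wpDl.
  by rewrite mulrA mulrCA divff ?gt_eqF// mulr1 ltr_pdivrMr// ltr_pMr// ltr1n.
have Hbd x b : boundary (dom D) x -> ctrlB D b ->
    closure (dom D) (x - ell *: gamma D x b) /\
    ell * c <= phi x - phi (x - ell *: gamma D x b).
  move=> bx Bb; split.
    by apply: subset_closure; apply: Hs0 => //; rewrite ell0 ltW.
  have H1 : - ell <= 0 by rewrite oppr_le0 ltW.
  have H2 : - c < - ell by rewrite ltrN2.
  have := barrier_increment HD Cphi Hphi bx Bb H1 H2 cpos.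
  by rewrite sub0r opprK scale0r addr0 scaleNr.
pose Z n := C0 + C2 * (horizon D - tgrid D NT n).
have tS n : tgrid D NT n.+1 = tgrid D NT n + dt D NT.
  by rewrite /tgrid -natr1 mulrDl mul1r.
have bound n : (n <= NT)%N -> forall i, `|U n i| <= K * phi (vtx M i) + Z n.
  move=> nNT; rewrite -(subKn nNT); elim: (NT - n)%N (leq_subr n NT) => [_ i|k IH kNT].
    rewrite subn0 UT /Z tgrid_horizon// subrr mulr0 addr0.
    have [cv _ _ _ _] := HM.
    have := HPsi _ (cv i); have := HP _ (cv i).
    rewrite ler_norml => /andP[H _]; have : K * (- CP) <= K * phi (vtx M i).
      by rewrite ler_wpM2l// ltW.
    by rewrite /C0; lra.
  have {IH} := IH (ltnW kNT).
  have kS : (NT - k = (NT - k.+1).+1)%N by rewrite subnSK.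
  rewrite kS; set n' := (NT - k.+1)%N => HU.
  have n'NT : (n' < NT)%N by rewrite /n' subnSK// leq_subr.
  have [Uint Ubd] := Ustep n' n'NT.
  apply: (boundary_barrier HD HM (ltW K0) herr NT0 n'NT HG (ltW ell0) Hbd gap) => //.
  move=> i Oi; rewrite Uint//.
  apply: (le_trans (interior_barrier (CX := CX) (Fb := G) HD HM (ltW K0) herr
    gK NT0 n'NT Oi HG _ _ _ HU)).
  - by move=> t x a t01 cx Aa; have [] := HC t x a t01 cx Aa.
  - move=> a b s Aa Bb; apply: (Heta (vtx M i)) => //.
    apply: le_lt_trans sqd; apply: Xstar_displacement; first by rewrite d0.
      by have [] := HC _ _ a (tgrid_in HD NT0 (ltnW n'NT)) (subset_closure Oi) Aa.
    by have [] := HC _ _ a (tgrid_in HD NT0 (ltnW n'NT)) (subset_closure Oi) Aa.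
  - by move=> a Aa; apply: HX => //; [exact: ltnW|exact: subset_closure].
  have KE : K * E <= K * E0 * dt D NT by rewrite /E mulrA ler_wpM2l.
  by rewrite /Z tS /C2; lra.
move=> n nNT i; apply: (le_trans (bound n nNT i)).
have [cv _ _ _ _] := HM.
have : K * phi (vtx M i) <= K * CP.
  by rewrite ler_wpM2l ?(ltW K0)// (le_trans (ler_norm _))// HP.
have /andP[t0 _] := tgrid_in HD NT0 nNT.
have : C2 * (horizon D - tgrid D NT n) <= C2 * horizon D.
  by rewrite ler_wpM2l// lerBlDr lerDl.
by rewrite /Z; lra.
Qed.

(* The discretization parameters are pairs p = (l, N_T), where l indexes the mesh
   family; the limit is taken along an arbitrary filter F on these pairs. *)
Theorem proposition4p3 (R : realType) (N Np NA NB : nat)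
    (D : problem R N Np NA NB) (L : Type) (M : L -> mesh R N)
    (c0 c1 : R) (ell : L -> R) (F : set_system (L * nat)) (FF : Filter F) :
  standing_assumptions D ->
  mesh_family (dom D) M ->
  0 < c0 -> c0 <= c1 ->
  (forall l, c0 * meshsize (M l) <= ell l <= c1 * meshsize (M l)) ->
  (\forall p \near F, (0 < p.2)%N) ->
  (fun p => dt D p.2) @ F --> (0 : R) ->
  (fun p => meshsize (M p.1)) @ F --> (0 : R) ->
  (fun p => meshsize (M p.1) ^+ 2 / dt D p.2) @ F --> (0 : R) ->
  exists C : R, \forall p \near F,
    forall U : nat -> vidx (M p.1) -> R,
      discrete_solution D (ell p.1) p.2 U ->
      \big[Num.max/0]_(n < p.2.+1) gridnorm (U n) <= C.
Proof.
move=> HD [HM _ [Cm Herr]] c00 _ Hell NT0 dt0 h0 hdt0.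
have [C [theta [theta0 HC]]] := @stability_estimate R N Np NA NB D c0 c1 Cm HD c00.
exists `|C|; near=> p => U HU.
have p0 : (0 < p.2)%N by near: p; exact: NT0.
have dp0 := dt_gt0 HD p0.
have dtp : dt D p.2 <= theta.
  apply: (le_trans (ler_norm _)).
  near: p; move/cvgrPdist_le: dt0 => /(_ theta theta0).
  by apply: filterS => p; rewrite sub0r normrN.
have hp : meshsize (M p.1) <= theta.
  apply: (le_trans (ler_norm _)).
  near: p; move/cvgrPdist_le: h0 => /(_ theta theta0).
  by apply: filterS => p; rewrite sub0r normrN.
have hdtp : meshsize (M p.1) ^+ 2 <= dt D p.2.
  have H : meshsize (M p.1) ^+ 2 / dt D p.2 <= 1.
    apply: (le_trans (ler_norm _)).
    near: p; move/cvgrPdist_le: hdt0 => /(_ 1 ltr01).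
    by apply: filterS => p; rewrite sub0r normrN.
  by move: H; rewrite ler_pdivrMr// mul1r.
apply: bigmax_le => [|n _]; first exact: normr_ge0.
apply: bigmax_le => [|i _]; first exact: normr_ge0.
apply: (le_trans _ (ler_norm C)).
by apply: (HC _ _ _ _ (HM p.1) (Herr p.1) (Hell p.1) p0 dtp hp hdtp HU); rewrite -ltnS.
Unshelve. all: by end_near. Qed.
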